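(* Let $V$ be a locally convex space, $\Omega\subset V$ open, $I=[\alpha,\beta]\subset\mathbb R$, and let $g$ be a Riemannian metric on $\Omega$ that admits a Levi–Civita connection. (a) A curve $x\in C^2(I,\Omega)$ is energy critical if and only if it is a geodesic. (b) Suppose there is a family $L$ of continuous linear forms on $V$ such that $\bigcap\{\ker l\colon l\in L\}=(0)$, and for every $l\in L$ and $v\in\Omega$ there is an $\eta\in V$ with $l=g(v,\eta,\cdot)$. Then every energy critical $x\in C^1(I,\Omega)$ is $C^2$, and hence is a geodesic.
   Context: All locally convex spaces are real, Hausdorff and sequentially complete. $f$ is $C^1$ if directional derivatives $df(v,\xi)=\lim_{t\to0}(f(v+t\xi)-f(v))/t$ exist and $df$ is continuous; $C^k$ inductively; for a subset $S$, $C^k(S,W)$ means maps extending to $C^k$ maps on an open neighborhood of $S$. A Riemannian metric on $\Omega$ is a map $g\colon\Omega\times V\times V\to\mathbb R$ with each $g(v,\cdot,\cdot)$ positive definite symmetric bilinear. For a $C^1$ metric $g$, a Levi–Civita connection is $D_\xi\varphi(v)=d\varphi(v,\xi)+A(v,\xi)\varphi(v)$ with $A(v,\xi)$ a continuous linear map $V\to V$, linear in $\xi$, $(v,\xi,w)\mapsto A(v,\xi)w$ continuous, $A(v,\xi)\eta=A(v,\eta)\xi$, and $\xi g(\cdot,\varphi,\psi)=g(\cdot,D_\xi\varphi,\psi)+g(\cdot,\varphi,D_\xi\psi)$ for all $\xi\in V$, $\varphi,\psi\in C^1(\Omega,V)$. A geodesic is a $C^2$ curve $x$ with $\ddot x+A(x,\dot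 x)\dot x=0$. The energy of $x\in C^1(I,\Omega)$ is $E(x)=\frac12\int_\alpha^\beta g\big(x(t),\dot x(t),\dot x(t)\big)dt$; $E$ is a $C^1$ function on the open subset $C^1(I,\Omega)$ of the locally convex space $C^1(I,V)$ (topologized by the seminorms $\sup_I p(u)$, $\sup_I p(\dot u)$ for continuous seminorms $p$ on $V$). For $a,b\in\Omega$, $C^1_{ab}(I,\Omega)=\{x\in C^1(I,\Omega)\colon x(\alpha)=a,\ x(\beta)=b\}$. A curve $x\in C^1(I,\Omega)$ is energy critical if it is a critical point of $E$ restricted to $C^1_{x(\alpha)x(\beta)}(I,\Omega)$, i.e. $dE(x,y)=0$ for all $y\in C^1(I,V)$ with $y(\alpha)=y(\beta)=0$. *)

(* Defs.v *)
(* MathComp-Analysis (tvsType = locally convex tvs) *)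
From HB Require Import structures.
From mathcomp Require Import all_boot all_order all_algebra.
From mathcomp Require Import all_classical all_reals all_analysis.
Set Implicit Arguments. Unset Strict Implicit. Unset Printing Implicit Defensive.
Import Order.TTheory GRing.Theory Num.Theory.
Import numFieldNormedType.Exports.
Local Open Scope classical_set_scope.
Local Open Scope ring_scope.

Section Defs.
Variable R : realType.

(** The limit of a filter on a tvs (default 0 when there is none). *)
Definition tlim (E : tvsType R) (F : set_system E) : E := xget 0 [set l | F --> l].

Definition ddir (E F : tvsType R) (f : E -> F) (v xi : E) : F :=
  tlim ((fun t : R => t^-1 *: (f (v + t *: xi) - f v)) @ 0^').

Definition isC1 (E F : tvsType R) (U : set E) (f : E -> F) : Prop :=
  (forall v xi, U v ->
     exists l : F, (fun t : R => t^-1 *: (f (v + t *: xi) - f v)) @ 0^' --> l)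
  /\ (forall p : E * E, U p.1 -> {for p, continuous (fun q : E * E => ddir f q.1 q.2)}).

Definition isC2 (E F : tvsType R) (U : set E) (f : E -> F) : Prop :=
  isC1 U f /\ isC1 (U `*` setT) (fun q : E * E => ddir f q.1 q.2).

Definition seq_complete (V : tvsType R) : Prop :=
  forall u : nat -> V,
    (forall U : set V, nbhs 0 U ->
       \forall n \near \oo & m \near \oo, U (u n - u m)) ->
    exists l : V, u @ \oo --> l.

Variable V : tvsType R.

Definition curveC1 (a b : R) (Om : set V) (x : R -> V) : Prop :=
  (forall t, a <= t <= b -> Om (x t)) /\
  exists U : set R^o, open U /\ [set t | a <= t <= b] `<=` U /\
    exists y : R^o -> V, isC1 U y /\ (forall t, a <= t <= b -> y t = x t).

Definition curveC2 (a b : R) (Om : set V) (x : R -> V) : Prop :=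
  (forall t, a <= t <= b -> Om (x t)) /\
  exists U : set R^o, open U /\ [set t | a <= t <= b] `<=` U /\
    exists y : R^o -> V, isC2 U y /\ (forall t, a <= t <= b -> y t = x t).

(** Derivative of a curve at t in I = [a,b] (one-sided at the end points),
    computed from the values on I only. *)
Definition cder (a b : R) (x : R -> V) (t : R) : V :=
  tlim ((fun s : R => (s - t)^-1 *: (x s - x t))
         @ within [set s | a <= s <= b /\ s != t] (nbhs t)).

Definition cder2 (a b : R) (x : R -> V) (t : R) : V :=
  cder a b (cder a b x) t.

Definition riemannian_metric (Om : set V) (g : V -> V -> V -> R) : Prop :=
  forall v, Om v ->
    (forall xi eta, g v xi eta = g v eta xi) /\
    (forall (c : R) xi xi' eta, g v (c *: xi + xi') eta = c * g v xi eta + g v xi' eta) /\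
    (forall xi, xi != 0 -> 0 < g v xi xi).

Definition metric_C1 (Om : set V) (g : V -> V -> V -> R) : Prop :=
  isC1 (Om `*` setT `*` setT) (fun p : V * V * V => (g p.1.1 p.1.2 p.2 : R^o)).

(** A is (the Christoffel map of) a Levi-Civita connection for g :
    D_xi phi (v) = dphi(v,xi) + A(v,xi) phi(v). *)
Definition levi_civita (Om : set V) (g : V -> V -> V -> R)
    (A : V -> V -> V -> V) : Prop :=
  (forall v xi, Om v ->
     (forall (c : R) u w, A v xi (c *: u + w) = c *: A v xi u + A v xi w)
     /\ continuous (A v xi)) /\
  (forall v, Om v -> forall (c : R) xi eta w,
     A v (c *: xi + eta) w = c *: A v xi w + A v eta w) /\
  (forall p : V * V * V, Om p.1.1 ->
     {for p, continuous (fun q : V * V * V => A q.1.1 q.1.2 q.2)}) /\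
  (forall v xi eta, Om v -> A v xi eta = A v eta xi) /\
  (forall (xi : V) (phi psi : V -> V), isC1 Om phi -> isC1 Om psi ->
     forall v, Om v ->
       (fun t : R => t^-1 * (g (v + t *: xi) (phi (v + t *: xi)) (psi (v + t *: xi))
                             - g v (phi v) (psi v)))
         @ 0^' -->
       g v (ddir phi v xi + A v xi (phi v)) (psi v)
       + g v (phi v) (ddir psi v xi + A v xi (psi v))).

Definition energy (g : V -> V -> V -> R) (a b : R) (x : R -> V) : R :=
  2^-1 * (\int[@lebesgue_measure R]_(t in `[a, b]) g (x t) (cder a b x t) (cder a b x t))%R.

Definition energy_critical (g : V -> V -> V -> R) (a b : R) (x : R -> V) : Prop :=
  forall y : R -> V, curveC1 a b setT y -> y a = 0 -> y b = 0 ->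
    (fun s : R => s^-1 * (energy g a b (fun t => x t + s *: y t) - energy g a b x))
      @ 0^' --> 0.

Definition geodesic (Om : set V) (A : V -> V -> V -> V) (a b : R) (x : R -> V) : Prop :=
  curveC2 a b Om x /\
  forall t, a <= t <= b -> cder2 a b x t + A (x t) (cder a b x t) (cder a b x t) = 0.

Definition cont_linear_form (l : V -> R) : Prop :=
  (forall (c : R) u w, l (c *: u + w) = c * l u + l w) /\ continuous (l : V -> R^o).

End Defs.

(* Main.v *)
(** Write D for the covariant derivative along the curve [x], so that
    D y = y' + A(x, x') y and (g(x, p, q))' = g(x, D p, q) + g(x, p, D q).
    Since A is symmetric, the first variation is dE(x, y) = int g(x, x', D y).
    For [x] of class C^2 and y vanishing at the end points this equals
    - int g(x, D x', y), so a geodesic is critical.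

    Conversely, for a critical curve of class C^1 take y = phi w with w in V
    constant and phi scalar. The lemma of du Bois-Reymond shows that
    g(x, x', w) is differentiable, with derivative g(x, x', A(x, x') w). For x
    of class C^2, comparison with the product rule gives g(x, D x', w) = 0 for
    all w. For (b), fix t0 and choose w with l = g(x(t0), ., w): freezing the
    base point at t0 shows that l(x') is differentiable at t0 with derivative
    - l(A(x, x') x'), without any regularity of w as a function of t0.
    Sequential completeness provides a primitive of - A(x, x') x' by Riemann
    sums; as L separates points, it differs from x' by a constant, so x is
    C^2. *)
Require Import Defs.
From HB Require Import structures.
From mathcomp Require Import all_boot all_order all_algebra.
From mathcomp Require Import all_classical all_reals all_analysis.
From mathcomp Require Import ring lra.
Import Order.TTheory GRing.Theory Num.Theory.
Import numFieldNormedType.Exports.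
Local Open Scope classical_set_scope.
Local Open Scope ring_scope.
Set Implicit Arguments. Unset Strict Implicit.

(** * Limits and seminorms in locally convex spaces *)

Lemma cvg_tvsD (R : realType) (V : tvsType R) (T : Type) (F : set_system T)
    {FF : Filter F} (f g : T -> V) (u v : V) :
  f @ F --> u -> g @ F --> v -> (fun x => f x + g x) @ F --> u + v.
Proof.
move=> fu gv.
exact: (@continuous2_cvg _ _ _ _ _ _ _ _ (fun x y : V => x + y) _ _
  (@add_continuous V (u, v)) fu gv).
Qed.

Lemma cvg_tvsZ (R : realType) (V : tvsType R) (T : Type) (F : set_system T)
    {FF : Filter F} (r : T -> R^o) (g : T -> V) (s : R^o) (v : V) :
  r @ F --> s -> g @ F --> v -> (fun x => r x *: g x) @ F --> s *: v.
Proof.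
move=> fu gv.
exact: (@continuous2_cvg _ _ _ _ _ _ _ _ (fun (x : R^o) (y : V) => x *: y) _ _
  (@scale_continuous R V (s, v)) fu gv).
Qed.

Lemma cvg_tvsN (R : realType) (V : tvsType R) (T : Type) (F : set_system T)
    {FF : Filter F} (f : T -> V) (u : V) :
  f @ F --> u -> (fun x => - f x) @ F --> - u.
Proof. by move=> fu; apply: continuous_cvg fu; exact: opp_continuous. Qed.

Lemma cvg_tvsB (R : realType) (V : tvsType R) (T : Type) (F : set_system T)
    {FF : Filter F} (f g : T -> V) (u v : V) :
  f @ F --> u -> g @ F --> v -> (fun x => f x - g x) @ F --> u - v.
Proof. by move=> fu gv; apply: cvg_tvsD => //; exact: cvg_tvsN. Qed.

(** The inequality [seminormZ] forces equality, since it also applies to [c^-1]. Smallness near 0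
    gives continuity everywhere by the triangle inequality. *)
Record is_seminorm (R : realType) (V : tvsType R) (p : V -> R) : Prop := IsSeminorm {
  seminorm_ge0 : forall u, 0 <= p u;
  seminormD : forall u v, p (u + v) <= p u + p v;
  seminormZ : forall c u, p (c *: u) <= `|c| * p u;
  seminorm_near0 : forall e, 0 < e -> \forall u \near (0 : V), p u < e }.

Lemma convex_setP (R : realType) (V : tvsType R) (W : set V) (u v : V) (r s : R) :
  @convex_set R V W -> W u -> W v -> 0 <= r -> 0 <= s -> r + s = 1 -> W (r *: u + s *: v).
Proof.
move=> cW Wu Wv r0 s0 rs1.
have r1 : r <= 1 by rewrite -rs1 lerDl.
have := cW u v (Itv01 r0 r1) (mem_set Wu) (mem_set Wv).
have -> : s = 1 - r by rewrite -rs1 addrC addKr.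
by move/set_mem.
Qed.

(** Through this lemma and [cvg_seminorm], convergence in a locally convex space is tested by real
    estimates, one continuous seminorm at a time. *)
Lemma seminorm_nbhs0 (R : realType) (V : tvsType R) (U : set V) : nbhs 0 U ->
  exists2 p : V -> R, is_seminorm p & forall u, p u < 1 -> U u.
Proof.
move=> U0.
have [B Bcvx [Bopen Bbasis]] := @locally_convex R V.
have [W [BW W0 WU]] := Bbasis 0 U U0.
have cW : @convex_set R V W by apply: Bcvx; exact/mem_set.
have oW : open W by exact: Bopen.
pose S (u : V) := [set t : R | 0 < t /\ W (t^-1 *: u) /\ W (- (t^-1 *: u))].
have nW : nbhs 0 (W `&` [set u | W (- u)]).
  apply: filterI; first exact: open_nbhs_nbhs.
  have := @opp_continuous V 0; rewrite /continuous_at oppr0; apply.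
  exact: open_nbhs_nbhs.
have Sn0 u : exists t, S u t.
  have : (fun t : R^o => t *: u) @ (0 : R^o) --> (0 : V).
    rewrite -[X in _ --> X](scale0r u); apply: cvg_tvsZ; first exact: cvg_id.
    exact: cvg_cst.
  move=> /(_ _ nW) /nbhs_ballP [e /= e0 He].
  exists (e / 2)^-1; split; first by rewrite invr_gt0 divr_gt0.
  rewrite invrK; apply: He; rewrite /ball /= sub0r normrN gtr0_norm ?divr_gt0//.
  by rewrite ltr_pdivrMr// ltr_pMr// ltrDl.
have Slb u : has_lbound (S u) by exists 0 => t [/ltW].
have Sinf u : has_inf (S u) by split; [exact: Sn0|exact: Slb].
(* [p] is the Minkowski functional of the symmetric convex set [W `&` - W] *)
pose p u := inf (S u).
have pS u t : S u t -> p u <= t by move=> St; apply: inf_lbound.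
have p0 u : 0 <= p u by apply: lb_le_inf; [exact: Sn0|move=> t [/ltW]].
have SN u t : S u t -> S (- u) t.
  by move=> [t0 [W1 W2]]; split=> //; rewrite scalerN opprK.
have SZ u t c : 0 < c -> S u t -> S (c *: u) (c * t).
  move=> c0 [t0 [W1 W2]]; split; first by rewrite mulr_gt0.
  by rewrite scalerA invfM mulrAC mulVf ?mul1r ?gt_eqF.
have pD u v : p (u + v) <= p u + p v.
  suff H s t : S u s -> S v t -> p (u + v) <= s + t.
    rewrite -lerBlDl; apply: lb_le_inf => // t St.
    rewrite lerBlDl -lerBlDr; apply: lb_le_inf => // s Ss.
    by rewrite lerBlDr; exact: H.
  move=> [s0 [Ws Ws']] [t0 [Wt Wt']]; apply: pS.
  have st0 : 0 < s + t by exact: addr_gt0.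
  split=> //.
  have -> : (s + t)^-1 *: (u + v) =
     (s / (s + t)) *: (s^-1 *: u) + (t / (s + t)) *: (t^-1 *: v).
    rewrite !scalerA scalerDr; congr (_ *: _ + _ *: _); field; lra.
  have s1 : 0 <= s / (s + t) by rewrite divr_ge0 ?ltW.
  have t1 : 0 <= t / (s + t) by rewrite divr_ge0 ?ltW.
  have st1 : s / (s + t) + t / (s + t) = 1 by rewrite -mulrDl divff ?gt_eqF.
  split; first exact: convex_setP.
  by rewrite opprD -(scalerN (s / _)) -(scalerN (t / _)); exact: convex_setP.
have pN u : p (- u) <= p u.
  by apply: lb_le_inf => // t /SN /pS.
have pZ0 c u : 0 < c -> p (c *: u) <= c * p u.
  move=> c0; rewrite -ler_pdivrMl//; apply: lb_le_inf => // t /(SZ _ _ _ c0)/pS.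
  by rewrite ler_pdivrMl.
have pZ c u : p (c *: u) <= `|c| * p u.
  have [c0|c0|->] := ltgtP c 0.
  - rewrite -[c]opprK scaleNr; apply: le_trans (pN _) _.
    by rewrite normrN; apply: le_trans (pZ0 _ _ _) _; rewrite ?oppr_gt0// gtr0_norm// oppr_gt0.
  - by rewrite gtr0_norm//; exact: pZ0.
  - rewrite scale0r normr0 mul0r; apply/ler_addgt0Pr => e e0; rewrite add0r.
    by apply: pS; split => //; rewrite scaler0 oppr0.
exists p; first split => // e e0.
  (* On the dilate of [W]&[- W] by [e / 2], a neighbourhood of 0, [p] is at most [e / 2]. *)
  have nWe := nbhs0Z (lt0r_neq0 (divr_gt0 e0 (ltr0Sn R 1))) nW.
  near=> u.
  have [w [Ww Ww'] <-] : (( *:%R (e / 2)) @` (W `&` [set u | W (- u)])) u by near: u.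
  have e20 : 0 < e / 2 by exact: divr_gt0.
  apply: le_lt_trans (pZ0 _ _ e20) _.
  have : p w <= 1 by apply: pS; split => //; rewrite invr1 scale1r.
  move=> pw1; apply: le_lt_trans (ler_wpM2l (ltW e20) pw1) _.
  by rewrite mulr1 ltr_pdivrMr// ltr_pMr// ltrDl.
move=> u pu1; apply: WU.
have [t [t0 [Wt _]] t1] := inf_lt (Sn0 u) pu1.
(* As [p u < 1], some [t < 1] has [t^-1 *: u] in [W]; then [u] lies on the segment from 0 to that
   point. *)
have -> : u = t *: (t^-1 *: u) + (1 - t) *: (0 : V).
  by rewrite scaler0 addr0 scalerA divff ?scale1r ?gt_eqF.
by apply: convex_setP => //; [exact: ltW|rewrite subr_ge0 ltW|rewrite addrC subrK].
Unshelve. all: by end_near. Qed.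

Lemma seminorm0 (R : realType) (V : tvsType R) (p : V -> R) : is_seminorm p -> p 0 = 0.
Proof.
move=> sp; apply/eqP; rewrite eq_le seminorm_ge0// andbT.
by rewrite -[X in p X](scale0r 0) (le_trans (seminormZ sp _ _))// normr0 mul0r.
Qed.

Lemma seminormN (R : realType) (V : tvsType R) (p : V -> R) u : is_seminorm p -> p (- u) <= p u.
Proof.
by move=> sp; rewrite -scaleN1r (le_trans (seminormZ sp _ _))// normrN1 mul1r.
Qed.

Lemma seminormB (R : realType) (V : tvsType R) (p : V -> R) u v :
  is_seminorm p -> p (u - v) <= p u + p v.
Proof.
by move=> sp; rewrite (le_trans (seminormD sp _ _))// lerD2l seminormN.
Qed.

Lemma seminorm_sum (R : realType) (V : tvsType R) (p : V -> R) (I : Type) (r : seq I) (u : I -> V) :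
  is_seminorm p -> p (\sum_(i <- r) u i) <= \sum_(i <- r) p (u i).
Proof.
move=> sp; elim: r => [|i r IH]; first by rewrite !big_nil seminorm0.
by rewrite !big_cons (le_trans (seminormD sp _ _))// lerD2l.
Qed.

Lemma cvg_seminorm (R : realType) (V : tvsType R) (T : Type) (F : set_system T)
    {FF : Filter F} (f : T -> V) (l : V) :
  (f @ F --> l) <->
  (forall p, is_seminorm p -> forall e, 0 < e -> \forall x \near F, p (f x - l) < e).
Proof.
split=> [fl p sp e e0|H].
  have : (fun x => f x - l) @ F --> (0 : V).
    by rewrite -[X in _ --> X](subrr l); apply: cvg_tvsB => //; exact: cvg_cst.
  by move=> /(_ _ (seminorm_near0 sp e0)).
have : (fun x => f x - l) @ F --> (0 : V).
  move=> U /seminorm_nbhs0[p sp pU]; apply: filterS (H p sp 1 ltr01) => x.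
  exact: pU.
move=> /cvg_tvsD/(_ (@cvg_cst _ l _ _ _)); rewrite add0r.
by apply: cvg_trans; apply: near_eq_cvg; near=> x; rewrite subrK.
Unshelve. all: by end_near. Qed.

(** Relational form of [ddir], free of the default value of [tlim]; [dlim_ddir] leads back to [ddir]
    in a Hausdorff space. *)
Definition dlim (R : realType) (E F : tvsType R) (f : E -> F) (v xi : E) (l : F) :=
  (fun t : R => t^-1 *: (f (v + t *: xi) - f v)) @ 0^' --> l.

Lemma cvg_tlim (R : realType) (E : tvsType R) (F : set_system E) (l : E) :
  F --> l -> F --> tlim F.
Proof. by move=> Fl; rewrite /tlim; case: xgetP => [x _ //|/(_ l)]. Qed.

Lemma cvg_near_eq (T : Type) (U : nbhsType) (F : set_system T) {FF : Filter F}
    (f g : T -> U) (l : U) :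
  (f @ F --> l) -> (\forall x \near F, f x = g x) -> (g @ F --> l).
Proof. by move=> fl fg; apply: cvg_trans fl; exact: near_eq_cvg. Qed.

(** * Primitives of continuous curves *)

(** Compactness of the segment, in its near-covering form: the thresholds found near each [t] merge
    into a single one. *)
Lemma segment_near (R : realType) (c d : R) (I : Type) (F : set_system I) {FF : Filter F}
    (P : I -> R -> Prop) :
  (forall t, c <= t <= d -> \forall t' \near t & i \near F, P i t') ->
  \forall i \near F, forall t, c <= t <= d -> P i t.
Proof.
move=> H; have /compact_near_coveringP := @segment_compact R c d.
move=> /(_ I F P FF) K; have : \forall i \near F, `[c, d] `<=` P i.
  by apply: K => t /=; rewrite in_itv/=; exact: H.
by apply: filterS => i + t tcd; apply; rewrite /= in_itv.
Qed.

(** Heine-Cantor for one seminorm. Only [t] is confined to the segment: continuity there is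
    two-sided, so [s] may leave it. *)
Lemma seminorm_unif_cont (R : realType) (V : tvsType R) (p : V -> R) (f : R -> V) (c d e : R) :
  is_seminorm p -> (forall t, c <= t <= d -> {for t, continuous f}) -> 0 < e ->
  exists2 del, 0 < del & forall s t, c <= t <= d -> `|s - t| < del -> p (f s - f t) <= e.
Proof.
move=> sp fc e0.
suff: \forall del \near 0^'+, forall t, c <= t <= d ->
    forall s, `|s - t| < del -> p (f s - f t) <= e.
  move=> H; have : \forall del \near (0 : R)^'+, 0 < del /\ forall t, c <= t <= d ->
    forall s, `|s - t| < del -> p (f s - f t) <= e.
    by near=> del; split; [near: del; exact: nbhs_right_gt|near: del].
  move=> /(@filter_ex _ _ _) [del [del0 Hd]].
  by exists del => // s t tcd; exact: Hd.
apply: segment_near => t0 t0cd.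
have e20 : 0 < e / 2 by exact: divr_gt0.
have /cvg_seminorm/(_ p sp _ e20)/nbhs_ballP[r /= r0 Hr] := fc _ t0cd.
have r20 : 0 < r / 2 by exact: divr_gt0.
exists (ball t0 (r / 2), [set x | x < r / 2]).
  by split; [exact: nbhsx_ballx|exact: nbhs_right_lt].
move=> [t del] /= [Bt dr] s sd.
have /Hr pt : ball t0 r t by apply: le_ball Bt; rewrite ler_pdivrMr// ler_pMr// lerDl.
have /Hr ps : ball t0 r s.
  rewrite [r]splitr; apply: ball_triangle Bt _.
  by rewrite /ball/= distrC; exact: lt_trans sd dr.
have -> : f s - f t = (f s - f t0) - (f t - f t0) by rewrite opprB addrA subrK.
by rewrite (le_trans (seminormB _ _ sp))// [e]splitr ltW// ltrD.
Unshelve. all: by end_near. Qed.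

(* The primitive of the step function with value [f (c + k h)] on [[c + k h, c + (k+1) h[]: the
   increment of the [k]-th coefficient over [[s, t]] is the length of the overlap with that step. *)
Definition rsum (R : realType) (V : tvsType R) (f : R -> V) (c h : R) (n : nat) (t : R) : V :=
  \sum_(k < n) (Num.min t (c + k.+1%:R * h) - Num.min t (c + k%:R * h)) *: f (c + k%:R * h).

(** The increments [lam k] of the coefficients from [s] to [t] are nonnegative, have sum [t - s],
    and vanish unless the node lies in [[s - h, t]]. So the increment of [rsum] is [t - s] times an
    average of samples of [f] taken near [[s, t]]. *)
Lemma rsumB (R : realType) (V : tvsType R) (p : V -> R) (f : R -> V) (c h : R) (n : nat)
    (s t e : R) (v : V) :
  is_seminorm p -> 0 < h -> c <= s -> s <= t -> t <= c + n%:R * h ->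
  (forall k, (k < n)%N -> s - h <= c + k%:R * h <= t -> p (f (c + k%:R * h) - v) <= e) ->
  p (rsum f c h n t - rsum f c h n s - (t - s) *: v) <= (t - s) * e.
Proof.
move=> sp h0 cs st tn H.
pose m (t : R) k := Num.min t (c + k%:R * h).
pose lam k := (m t k.+1 - m t k) - (m s k.+1 - m s k).
have lamsum : \sum_(k < n) lam k = t - s.
  rewrite /lam sumrB -!(big_mkord xpredT (fun k => m _ k.+1 - m _ k)) !telescope_sumr//.
  rewrite /m mul0r addr0 (min_l tn) (min_l (le_trans st tn)) (min_r cs).
  by rewrite (min_r (le_trans cs st)); ring.
have kh k : c + k.+1%:R * h = c + k%:R * h + h by rewrite -natr1 mulrDl mul1r addrA.
have lamE k : lam k = 0 \/ (0 <= lam k /\ s - h <= c + k%:R * h <= t).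
  rewrite /lam /m kh; set x := c + k%:R * h.
  rewrite /Num.min; do 4 (case: ltP => ?); solve [left; lra|right; split; lra].
have -> : rsum f c h n t - rsum f c h n s - (t - s) *: v =
   \sum_(k < n) lam k *: (f (c + k%:R * h) - v).
  rewrite -lamsum scaler_suml /rsum -!sumrB; apply: eq_bigr => k _.
  by rewrite scalerBr -scalerBl.
rewrite (le_trans (seminorm_sum _ _ sp))// -lamsum mulr_suml; apply: ler_sum => k _.
rewrite (le_trans (seminormZ sp _ _))//.
have [->|[l0 kst]] := lamE k; first by rewrite normr0 !mul0r.
by rewrite ger0_norm// ler_wpM2l// H.
Qed.

(** A Lipschitz bound valid at small scale propagates: walk from [t] back to [c] in steps of length
    [eta / 2] and add the increments. *)
Lemma seminorm_chain (R : realType) (V : tvsType R) (p : V -> R) (q : R -> V) (c d eta K : R) :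
  is_seminorm p -> 0 < eta ->
  (forall s t, c <= s -> s <= t -> t <= d -> t - s < eta -> p (q t - q s) <= (t - s) * K) ->
  forall t, c <= t <= d -> p (q t - q c) <= (t - c) * K.
Proof.
move=> sp eta0 H t /andP[ct td].
have e20 : 0 < eta / 2 by exact: divr_gt0.
suff G (N : nat) : forall t, c <= t <= d -> t - c <= N%:R * (eta / 2) ->
    p (q t - q c) <= (t - c) * K.
  apply: (G (Num.bound ((t - c) / (eta / 2)))); first exact/andP.
  rewrite -ler_pdivrMr// ltW// archi_boundP// divr_ge0 ?(ltW e20)//.
  by rewrite subr_ge0.
elim: N => [|N IH] {ct td}t /andP[ct td].
  rewrite mul0r => tc; have -> : t = c by lra.
  by rewrite !subrr mul0r seminorm0.
rewrite -natr1 mulrDl mul1r => tN.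
have [tN'|tN'] := leP (t - c) (N%:R * (eta / 2)); first by apply: IH => //; exact/andP.
have N0 : 0 <= N%:R * (eta / 2) by rewrite mulr_ge0// ltW.
have [tce|tce] := leP (t - c) (eta / 2); first by apply: H => //; lra.
have -> : q t - q c = (q t - q (t - eta / 2)) + (q (t - eta / 2) - q c).
  by rewrite addrA subrK.
rewrite (le_trans (seminormD sp _ _))//.
have -> : (t - c) * K = (t - (t - eta / 2)) * K + ((t - eta / 2) - c) * K by ring.
apply: lerD; first by apply: H; lra.
by apply: IH; [apply/andP; split|]; lra.
Qed.

(** The Riemann sums [Fn n] are Cauchy, uniformly on the segment, because for fine meshes all their
    increments over a short [[s, t]] are close to [(t - s) *: f s]. The same increment estimate
    survives in the limit and gives the derivative. *)
Lemma primitive_exists (R : realType) (V : tvsType R) (HVc : seq_complete V)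
    (f : R -> V) (c d : R) : c < d ->
  (forall t, c <= t <= d -> {for t, continuous f}) ->
  exists F : R -> V, forall t, c < t < d -> dlim (F : R^o -> V) t 1 (f t).
Proof.
move=> cd fc.
pose h n := (d - c) / n.+1%:R.
have h0 n : 0 < h n by rewrite divr_gt0// subr_gt0.
have hn n : c + n.+1%:R * h n = d by rewrite /h mulrC divfK ?pnatr_eq0// addrC subrK.
have hsmall eta : 0 < eta -> exists N, forall n, (N <= n)%N -> h n < eta.
  move=> eta0; exists (Num.bound ((d - c) / eta)) => n Nn.
  rewrite /h ltr_pdivrMr// mulrC -ltr_pdivrMr//.
  apply: lt_le_trans (archi_boundP _) _; last by rewrite ler_nat ltnW.
  by rewrite divr_ge0 ?(ltW eta0)// subr_ge0 ltW.
pose Fn n t := rsum f c (h n) n.+1 t.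
have local p e : is_seminorm p -> 0 < e -> exists2 eta, 0 < eta &
    forall n s t, h n < eta -> c <= s -> s <= t -> t <= d -> t - s < eta ->
      p (Fn n t - Fn n s - (t - s) *: f s) <= (t - s) * e.
  move=> sp e0; have [del del0 Hd] := seminorm_unif_cont sp fc e0.
  exists del => // n s t hd cs st td tsd; rewrite /Fn; apply: rsumB => //; first by rewrite hn.
  move=> k kn /andP[k1 k2]; apply: Hd; first by apply/andP; split; lra.
  by rewrite ltr_norml; apply/andP; split; lra.
have Fn0 n : Fn n c = 0.
  rewrite /Fn /rsum big1// => k _; rewrite !min_l ?subrr ?scale0r// lerDl mulr_ge0// ltW//.
have cauchy p e : is_seminorm p -> 0 < e -> exists N, forall n m t,
    (N <= n)%N -> (N <= m)%N -> c <= t <= d -> p (Fn n t - Fn m t) < e.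
  (* Two sums differ by at most [(d - c) * (e' + e') = e / 2], which leaves a strict inequality. *)
  move=> sp e0; pose e' := e / (4%:R * (d - c)).
  have dc0 : 0 < d - c by rewrite subr_gt0.
  have e'0 : 0 < e' by rewrite divr_gt0// mulr_gt0.
  have [eta eta0 He] := local p e' sp e'0.
  have [N HN] := hsmall eta eta0; exists N => n m t Nn Nm tcd.
  have := @seminorm_chain R V p (fun t => Fn n t - Fn m t) c d eta (e' + e') sp eta0 _ t tcd.
  rewrite !Fn0 !subr0 => H; apply: le_lt_trans (H _) _; first (move=> s r cs sr rd rse).
    have -> : Fn n r - Fn m r - (Fn n s - Fn m s) =
      (Fn n r - Fn n s - (r - s) *: f s) - (Fn m r - Fn m s - (r - s) *: f s).
      by rewrite [X in _ = _ - _ + X]opprB [RHS]subrKA !opprD !opprK addrACA.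
    rewrite (le_trans (seminormB _ _ sp))// mulrDr.
    by apply: lerD; apply: He => //; exact: HN.
  have -> : e = (d - c) * (e' + e') + e / 2 by rewrite /e'; field; lra.
  have : (t - c) * (e' + e') <= (d - c) * (e' + e').
    by rewrite ler_wpM2r//; [lra|case/andP: tcd; lra].
  by move=> ?; lra.
pose F t : V := tlim (Fn ^~ t @ \oo).
have FE t : c <= t <= d -> Fn ^~ t @ \oo --> F t.
  move=> tcd; suff [l Hl] : exists l : V, Fn ^~ t @ \oo --> l by exact: cvg_tlim Hl.
  apply: HVc => U /seminorm_nbhs0[p sp pU].
  have [N HN] := cauchy p 1 sp ltr01.
  exists ([set n | (N <= n)%N], [set n | (N <= n)%N]).
    by split; exists N.
  by move=> [n m] /= [Nn Nm]; apply: pU; exact: HN.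
(* The window opens at [s - eta] rather than [s]: the step containing [s] is sampled at its left
   end, up to one mesh width before [s]. *)
have incr p v e eta s t : is_seminorm p -> 0 < eta -> c <= s -> s <= t -> t <= d ->
    (forall r, s - eta <= r <= t -> p (f r - v) <= e) ->
    p (F t - F s - (t - s) *: v) <= (t - s) * e.
  move=> sp eta0 cs st td H; apply/ler_addgt0Pr => e' e'0.
  have e20 : 0 < e' / 2 by exact: divr_gt0.
  have tcd : c <= t <= d by apply/andP; split => //; exact: le_trans st.
  have scd : c <= s <= d by apply/andP; split => //; exact: le_trans st td.
  have [N HN] := hsmall eta eta0.
  near \oo => n.
  have -> : F t - F s - (t - s) *: v = (Fn n t - Fn n s - (t - s) *: v)
     + ((Fn n s - F s) - (Fn n t - F t)).
    rewrite [X in _ = _ + (_ + X)]opprB [RHS]addrACA subrKA [RHS]addrC.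
    rewrite [- _ + (_ - _)]addrA [RHS]subrKA.
    by rewrite [- _ + F t]addrC addrAC.
  rewrite (le_trans (seminormD sp _ _))// lerD//.
    rewrite /Fn; apply: rsumB => //; first by rewrite hn.
    move=> k kn /andP[k1 k2]; apply: H; rewrite k2 andbT; apply: le_trans k1.
    by rewrite lerD2l lerN2 ltW// HN//; near: n; exists N.
  rewrite (le_trans (seminormB _ _ sp))// [e']splitr lerD//; apply: ltW; near: n.
    by have /cvg_seminorm := FE _ scd; apply.
  by have /cvg_seminorm := FE _ tcd; apply.
exists F => t0 /andP[ct0 t0d]; apply/cvg_seminorm => p sp e e0.
have e20 : 0 < e / 2 by exact: divr_gt0.
have t0cd : c <= t0 <= d by rewrite !ltW.
have /cvg_seminorm/(_ p sp _ e20)/nbhs_ballP[r /= r0 Hr] := fc _ t0cd.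
have r20 : 0 < r / 2 by exact: divr_gt0.
near=> x.
have x0 : x != 0 by near: x; exact: nbhs_dnbhs_neq.
have xr : `|x| < r / 2.
  near: x; apply: dnbhs0_lt => //.
have xc : `|x| < t0 - c by near: x; apply: dnbhs0_lt; rewrite subr_gt0.
have xd : `|x| < d - t0 by near: x; apply: dnbhs0_lt; rewrite subr_gt0.
have Hr' s : `|s - t0| < r -> p (f s - f t0) <= e / 2.
  by move=> sr; apply/ltW/Hr; rewrite /ball/= distrC.
have -> : t0 + x *: (1 : R^o) = t0 + x by rewrite /GRing.scale/= mulr1.
move: xr xc xd; rewrite !ltr_norml => /andP[? ?] /andP[? ?] /andP[? ?].
have small : p (F (t0 + x) - F t0 - x *: f t0) <= `|x| * (e / 2).
  (* [incr] runs from left to right, so a negative [x] exchanges the end points; the comparison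
     value remains [f t0]. *)
  have [xn|xp|x00] := ltgtP x 0; last by move: x0; rewrite x00 eqxx.
    have := incr p (f t0) (e / 2) (r / 2) (t0 + x) t0 sp r20.
    rewrite ltr0_norm// opprD addrA subrr sub0r => H.
    rewrite -[X in p X]opprK (le_trans (seminormN _ sp))//.
    rewrite opprD opprB -scaleNr; apply: H; try lra.
    move=> s /andP[s1 s2]; apply: Hr'; rewrite ltr_norml; lra.
  have := incr p (f t0) (e / 2) (r / 2) t0 (t0 + x) sp r20.
  rewrite gtr0_norm// [t0 + x - t0]addrC addKr => H.
  apply: H; try lra.
  move=> s /andP[s1 s2]; apply: Hr'; rewrite ltr_norml; lra.
have -> : x^-1 *: (F (t0 + x) - F t0) - f t0 = x^-1 *: (F (t0 + x) - F t0 - x *: f t0).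
  by rewrite [RHS]scalerBr scalerA mulVf// scale1r.
apply: le_lt_trans (seminormZ sp _ _) _; rewrite normfV.
rewrite mulrC ltr_pdivrMr ?normr_gt0//; apply: le_lt_trans small _.
by rewrite mulrC ltr_pM2r ?normr_gt0// gtr_pMr// invf_lt1 ?ltr1n.
Unshelve. all: by end_near. Qed.

(** * Differential calculus along curves *)

(** With this, primitives of real functions come from the same construction as those of curves in
    [V]. *)
Lemma seq_complete_regular (R : realType) : @seq_complete R R^o.
Proof.
move=> u H; suff : cvg (u @ \oo) by move=> /cvg_ex.
apply: cauchy_cvg => A; rewrite -entourage_from_ballE => -[e /= e0 eA].
have [[P Q] /= [Poo Qoo] PQ] := H _ (nbhsx_ballx (0 : R^o) e e0).
exists (u @` P, u @` Q) => /=.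
  by split; [apply: filterS Poo|apply: filterS Qoo] => n Pn /=; exists n.
move=> [x y] /= [[n Pn <-] [m Qm <-]]; apply: eA => /=.
by have := PQ (n, m) (conj Pn Qm); rewrite /ball/= sub0r normrN.
Qed.

Lemma near_dnbhs0 (R : realType) (P : set R) : (\forall h \near 0^', P h) <->
  exists2 r, 0 < r & forall h, h != 0 -> `|h| < r -> P h.
Proof.
split.
  move=> /nbhs_ballP[r /= r0 H]; exists r => // h h0 hr; apply: H => //.
  by rewrite /ball/= sub0r normrN.
move=> [r r0 H]; apply/nbhs_ballP; exists r => //= h; rewrite /ball/= sub0r normrN => hr h0.
exact: H.
Qed.

Lemma near_shift (R : realType) (t : R) (P : set R) :
  (\forall h \near 0^', P (t + h)) -> P t -> \forall s \near t, P s.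
Proof.
move=> /near_dnbhs0[r r0 H] Pt; apply/nbhs_ballP; exists r => //= s.
rewrite /ball/= distrC => st; have [->//|nst] := eqVneq s t.
by rewrite -[s](subrKC t); apply: H; rewrite ?subr_eq0.
Qed.

Section Curves.
Variables (R : realType) (V : tvsType R).
Implicit Types (x y : R -> V) (t : R) (d : V).

Lemma dlimE x t d : dlim (x : R^o -> V) t 1 d <->
  (fun h : R => h^-1 *: (x (t + h) - x t)) @ 0^' --> d.
Proof.
rewrite /dlim; suff -> : (fun h : R => h^-1 *: (x (t + h *: (1 : R^o)) - x t)) =
  (fun h : R => h^-1 *: (x (t + h) - x t)) by [].
by apply/funext => h; rewrite /GRing.scale/= mulr1.
Qed.

Lemma dlim_continuous x t d : dlim (x : R^o -> V) t 1 d -> {for t, continuous x}.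
Proof.
move=> /dlimE H.
have {}H : (fun h : R => h *: (h^-1 *: (x (t + h) - x t)) + x t) @ 0^' --> (x t : V).
  rewrite -[X in _ --> X]add0r -(scale0r d); apply: cvg_tvsD; last exact: cvg_cst.
  by apply: cvg_tvsZ => //; exact: nbhs_dnbhs.
move=> U xU; apply: near_shift; last exact: (nbhs_singleton xU).
have := H U xU; rewrite near_simpl/= => HU; near=> h.
have h0 : h != 0 by near: h; exact: nbhs_dnbhs_neq.
have : U (h *: (h^-1 *: (x (t + h) - x t)) + x t) by near: h.
by rewrite scalerA divff// scale1r subrK.
Unshelve. all: by end_near. Qed.

Lemma dlimD x y t d d' : dlim (x : R^o -> V) t 1 d -> dlim (y : R^o -> V) t 1 d' ->
  dlim (fun s : R^o => x s + y s) t 1 (d + d').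
Proof.
rewrite !dlimE => H H'; apply: cvg_near_eq (cvg_tvsD H H') _.
by near=> h; rewrite -scalerDr opprD addrACA.
Unshelve. all: by end_near. Qed.

Lemma dlimZ (c : R) x t d : dlim (x : R^o -> V) t 1 d ->
  dlim (fun s : R^o => c *: x s) t 1 (c *: d).
Proof.
rewrite !dlimE => H; apply: cvg_near_eq (cvg_tvsZ (@cvg_cst _ (c : R^o) _ 0^' _) H) _.
by near=> h; rewrite -scalerBr !scalerA mulrC.
Unshelve. all: by end_near. Qed.

Lemma dlimN x t d : dlim (x : R^o -> V) t 1 d -> dlim (fun s : R^o => - x s) t 1 (- d).
Proof.
rewrite !dlimE => H; apply: cvg_near_eq (cvg_tvsN H) _.
by near=> h; rewrite -scalerN opprB opprK addrC.
Unshelve. all: by end_near. Qed.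

Lemma dlimB x y t d d' : dlim (x : R^o -> V) t 1 d -> dlim (y : R^o -> V) t 1 d' ->
  dlim (fun s : R^o => x s - y s) t 1 (d - d').
Proof. by move=> H /dlimN; exact: dlimD. Qed.

Lemma dlim_cst (v : V) t : dlim (fun _ : R^o => v) t 1 0.
Proof.
rewrite dlimE; apply: cvg_near_eq (@cvg_cst V 0 R 0^' _) _.
by near=> h; rewrite subrr scaler0.
Unshelve. all: by end_near. Qed.

End Curves.
Arguments dlim_cst {R V} v t.
Arguments dlimZ {R V} c {x t d} _.

Lemma dlim_scale (R : realType) (V : tvsType R) (phi : R -> R) (w : V) (t k : R) :
  dlim (phi : R^o -> R^o) t 1 k ->
  dlim (fun s : R^o => phi s *: w) t 1 (k *: w).
Proof.
move=> /dlimE H; apply/dlimE; apply: cvg_near_eq (cvg_tvsZ H (@cvg_cst _ w _ 0^' _)) _.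
by near=> h; rewrite -scalerBl scalerA.
Unshelve. all: by end_near. Qed.

Section OneSidedDerivative.
Variables (R : realType) (V : tvsType R) (a b : R) (hab : a < b).
Implicit Types (x y : R -> V) (t : R) (d : V).

Lemma proper_within_segment t : a <= t <= b ->
  ProperFilter (within [set s | a <= s <= b /\ s != t] (nbhs t)).
Proof.
move=> /andP[at_ tb]; apply: Build_ProperFilter_ex => P /nbhs_ballP[r /= r0 H].
have [tb'|bt] := ltP t b.
  (* A nearby point to the right of [t] if [t < b], to its left otherwise; the truncation keeps it
     in the segment, and [a < b] keeps it distinct from [t]. *)
  exists (Num.min b (t + r / 2)); apply: H; rewrite /ball/= ?ltr_norml /Num.min;
    case: (ltP b (t + r / 2)) => ?.
  - by apply/andP; split; lra.
  - by apply/andP; split; lra.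
  - by split; [apply/andP; split; lra|rewrite gt_eqF].
  - by split; [apply/andP; split; lra|rewrite gt_eqF//; lra].
exists (Num.max a (t - r / 2)); apply: H; rewrite /ball/= ?ltr_norml /Num.max;
  case: (ltP a (t - r / 2)) => ?.
- by apply/andP; split; lra.
- by apply/andP; split; lra.
- by split; [apply/andP; split; lra|rewrite lt_eqF//; lra].
- by split; [apply/andP; split; lra|rewrite lt_eqF//; exact: lt_le_trans hab bt].
Qed.

Hypothesis HV : hausdorff_space V.

Lemma cder_dlim x y t d : (forall s, a <= s <= b -> x s = y s) -> a <= t <= b ->
  dlim (y : R^o -> V) t 1 d -> cder a b x t = d.
Proof.
move=> xy tab /dlimE H.
have FF := proper_within_segment tab.
set F := within _ _ in FF.
suff xd : (fun s : R => (s - t)^-1 *: (x s - x t)) @ F --> d.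
  by apply: (cvg_unique HV _ xd); exact: cvg_tlim xd.
move=> U /H; rewrite near_simpl/= => /near_dnbhs0[r r0 HU].
apply/nbhs_ballP; exists r => //= s; rewrite /ball/= distrC => sr [sab st].
have := HU (s - t); rewrite /= subrKC => HU'.
by rewrite /= !xy//; apply: HU' => //; rewrite subr_eq0.
Qed.

Lemma dlim_ddir (E : tvsType R) (f : E -> V) v xi d : dlim f v xi d -> ddir f v xi = d.
Proof. by move=> H; apply: (cvg_unique HV _ H); exact: cvg_tlim H. Qed.

End OneSidedDerivative.

Lemma isC1_dlim (R : realType) (E F : tvsType R) (U : set E) (f : E -> F) v xi :
  isC1 U f -> U v -> dlim f v xi (ddir f v xi).
Proof. by move=> [H _] Uv; have [l Hl] := H v xi Uv; exact: cvg_tlim Hl. Qed.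

Section RealCalculus.
Variable R : realType.
Implicit Types (f F : R -> R) (a b t : R).

Lemma dlim_is_derive F t k : dlim (F : R^o -> R^o) t 1 k -> is_derive t 1 F k.
Proof.
move=> H; suff H' : (fun h : R => h^-1 *: ((F \o shift t) (h *: 1) - F t)) @ 0^' --> k.
  by apply: DeriveDef; [apply/cvg_ex; exists k|apply: cvg_lim].
move/dlimE: H => H; apply: cvg_near_eq H _; near=> h.
by rewrite /=; congr (_ *: (F _ - _)); rewrite /GRing.scale/= mulr1 addrC.
Unshelve. all: by end_near. Qed.

Lemma continuous_subsegment f a b :
  (forall t, a <= t <= b -> {for t, continuous f}) -> {within `[a, b], continuous f}.
Proof.
move=> H; apply: continuous_in_subspaceT => t /set_mem/=; rewrite in_itv/=; exact: H.
Qed.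

Lemma real_MVT F f a b : a < b ->
  (forall t, a <= t <= b -> dlim (F : R^o -> R^o) t 1 (f t)) ->
  exists2 c, a <= c <= b & F b - F a = f c * (b - a).
Proof.
move=> ab H; have [||c] := @MVT_segment R F f a b (ltW ab).
- by move=> t; rewrite in_itv/= => /andP[? ?]; apply: dlim_is_derive; apply: H; rewrite !ltW.
- by apply: continuous_subsegment => t /H; exact: dlim_continuous.
- by rewrite in_itv/=; exists c.
Qed.

Lemma real_FTC2 F f a b : a < b ->
  (forall t, a <= t <= b -> {for t, continuous f}) ->
  (forall t, a <= t <= b -> dlim (F : R^o -> R^o) t 1 (f t)) ->
  (\int[@lebesgue_measure R]_(t in `[a, b]) f t)%R = F b - F a.
Proof.
move=> ab fc H; rewrite /Rintegral (@continuous_FTC2 R f F a b ab).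
- by [].
- exact: continuous_subsegment.
- split.
  + move=> t; rewrite in_itv/= => /andP[? ?].
    by have [] := dlim_is_derive (H t _); rewrite ?ltW.
  + by apply: cvg_at_right_filter; apply: dlim_continuous (H a _); rewrite lexx ltW.
  + by apply: cvg_at_left_filter; apply: dlim_continuous (H b _); rewrite lexx ltW.
- move=> t; rewrite in_itv/= => /andP[? ?]; rewrite derive1E.
  by have [] := dlim_is_derive (H t _); rewrite ?ltW.
Qed.

End RealCalculus.

(** * Strict differentiability of C1 functions *)

Lemma near_triple (R : realType) (E F : topologicalType) (c : E) (v : F) (P : E -> R -> F -> Prop) :
  (\forall q \near ((c, (0 : R)), v), P q.1.1 q.1.2 q.2) ->
  exists r A B, [/\ 0 < r, nbhs c A, nbhs v B &
    forall p h u, A p -> `|h| < r -> B u -> P p h u].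
Proof.
move=> [[C B] /= [[[A D] /= [cA /nbhs_ballP[r /= r0 HD]] ADC] vB] CBP].
exists r, A, B; split => // p h u Ap hr Bu.
apply: (CBP ((p, h), u)); split => //=; apply: ADC; split => //=; apply: HD.
by rewrite /ball/= sub0r normrN.
Qed.

Lemma open_setXT (E F : topologicalType) (A : set E) : open A -> open (A `*` [set: F]).
Proof.
move=> oA; rewrite openE => -[v p] [/= Av _].
by exists (A, setT) => //; split; [exact: open_nbhs_nbhs|exact: filterT].
Qed.

Section StrictDifferentiability.
Variables (R : realType) (E : tvsType R) (U : set E) (oU : open U) (f : E -> R^o).
Hypothesis fC1 : isC1 U f.

(* Uniform differentiability: the base point [p] and the direction [u] of the
   difference quotient may vary with the increment [h]. *)
Lemma strict_diff (c v : E) (e : R) : U c -> 0 < e ->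
  exists r A B, [/\ 0 < r, nbhs c A, nbhs v B & forall p h u, A p -> `|h| < r -> B u ->
    U (p + h *: u) /\
    (h != 0 -> `|h^-1 * (f (p + h *: u) - f p) - ddir f c v| < e)].
Proof.
move=> Uc e0.
have cont : ((q.1.1 + q.1.2 *: q.2, q.2) @[q --> ((c, (0 : R)), v)]) --> (c, v).
  suff H : (q.1.1 + q.1.2 *: q.2) @[q --> ((c, (0 : R)), v)] --> c.
    by apply: cvg_pair H _; exact: cvg_snd.
  rewrite -[X in _ --> X](addr0 c) -(scale0r v).
  apply: cvg_tvsD; first exact: cvg_comp (@cvg_fst _ _ _ _ _) (@cvg_fst _ _ _ _ _).
  apply: cvg_tvsZ; last exact: cvg_snd.
  exact: cvg_comp (@cvg_fst _ _ _ _ _) (@cvg_snd _ _ _ _ _).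
have dc : {for (c, v), continuous (fun q : E * E => ddir f q.1 q.2)} by apply: fC1.2.
(* Continuity of [ddir f] at [(c, v)], pulled back along the map from [(p, h, u)] to
   [(p + h *: u, u)]. *)
have near1 : \forall q \near ((c, (0 : R)), v),
    U (q.1.1 + q.1.2 *: q.2) /\ `|ddir f (q.1.1 + q.1.2 *: q.2) q.2 - ddir f c v| < e.
  apply: (cont [set z | U z.1 /\ `|ddir f z.1 z.2 - ddir f c v| < e]).
  apply: filterI.
    by exists (U, setT) => /=; [split; [exact: open_nbhs_nbhs|exact: filterT]|move=> [? ?] []].
  have /cvgrPdist_lt/(_ e e0) := dc.
  by apply: filterS => z; rewrite distrC.
have [r [A [B [r0 cA vB H]]]] := near_triple
  (P := fun p h u => U (p + h *: u) /\ `|ddir f (p + h *: u) u - ddir f c v| < e) near1.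
exists r, A, B; split => // p h u Ap hr Bu; split; first exact: (H p h u Ap hr Bu).1.
move=> h0.
have der s : `|s| < r -> dlim (fun s : R^o => f (p + s *: u) : R^o) s 1 (ddir f (p + s *: u) u).
  move=> sr; apply/dlimE; have Us := (H p s u Ap sr Bu).1.
  have := isC1_dlim (xi := u) fC1 Us; rewrite /dlim => H0; apply: cvg_near_eq H0 _; near=> k.
  by rewrite scalerDl addrA.
(* By the mean value theorem along [s] in the direction [u], the quotient is a directional
   derivative at an intermediate point, which [H] controls. *)
suff [s sr ->] : exists2 s, `|s| < r &
    h^-1 * (f (p + h *: u) - f p) = ddir f (p + s *: u) u.
  exact: (H p s u Ap sr Bu).2.
move: hr; rewrite ltr_norml => /andP[h1 h2].
have [hn|hp|hz] := ltgtP h 0; last by move: h0; rewrite hz eqxx.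
  have [|s /andP[s1 s2] Hs] :=
    real_MVT (F := fun s => f (p + s *: u)) hn (f := fun s => ddir f (p + s *: u) u).
    by move=> s /andP[s1 s2]; apply: der; rewrite ltr_norml; apply/andP; split; lra.
  exists s; first by rewrite ltr_norml; apply/andP; split; lra.
  apply: (mulfI h0); rewrite mulrA divff// mul1r mulrC.
  by move: Hs; rewrite scale0r addr0 => Hs; rewrite -opprB Hs; ring.
have [|s /andP[s1 s2] Hs] :=
  real_MVT (F := fun s => f (p + s *: u)) hp (f := fun s => ddir f (p + s *: u) u).
  by move=> s /andP[s1 s2]; apply: der; rewrite ltr_norml; apply/andP; split; lra.
exists s; first by rewrite ltr_norml; apply/andP; split; lra.
apply: (mulfI h0); rewrite mulrA divff// mul1r mulrC.
by move: Hs; rewrite scale0r addr0 => Hs; rewrite Hs; ring.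
Unshelve. all: by end_near. Qed.

(** A moving direction yields the chain rule; a moving base point later serves to vary the foot
    point of the metric while its vector arguments change with [h]. *)
Lemma cvg_quotient (T : Type) (F : set_system T) {FF : Filter F} (p : T -> E) (h : T -> R)
    (u : T -> E) (c v : E) : U c ->
  p @ F --> c -> h @ F --> 0^' -> u @ F --> v ->
  (fun t => (h t)^-1 * (f (p t + h t *: u t) - f (p t))) @ F --> (ddir f c v : R^o).
Proof.
move=> Uc pc h0 uv; apply/cvgrPdist_lt => e e0.
have [r [A [B [r0 cA vB H]]]] := strict_diff v Uc e0.
have /h0 hr : (0 : R)^' [set k | k != 0 /\ `|k| < r].
  by apply/near_dnbhs0; exists r.
have /pc pA := cA; have /uv uB := vB.
near=> t; rewrite distrC.
have [ht0 htr] : h t != 0 /\ `|h t| < r by near: t.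
by apply: (H (p t) (h t) (u t) _ _ _).2 => //; near: t.
Unshelve. all: by end_near. Qed.

Lemma isC1_continuous (v : E) : U v -> {for v, continuous f}.
Proof.
move=> Uv; apply/cvgrPdist_lt => e e0.
have d0 : ddir f v 0 = 0.
  apply: dlim_ddir; first exact: norm_hausdorff.
  rewrite /dlim; apply: cvg_near_eq (@cvg_cst R^o 0 R 0^' _) _; near=> k.
  by rewrite scaler0 addr0 subrr scaler0.
have [r [A [B [r0 /nbhs_singleton Av vB H]]]] := strict_diff 0 Uv ltr01.
(* For [w] near [v] the direction [k^-1 *: (w - v)] is near 0, where the quotient with increment [k]
   is below 1. Hence [f w] is within [k < e] of [f v]. *)
pose k := Num.min (r / 2) (e / 2).
have k0 : 0 < k by rewrite lt_min !divr_gt0.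
have kr : k < r by rewrite gt_min gtr_pMr// invf_lt1 ?ltr1n.
have ke : k < e by rewrite gt_min orbC gtr_pMr// invf_lt1 ?ltr1n.
have : (fun w : E => k^-1 *: (w - v)) @ v --> (0 : E).
  rewrite -[X in _ --> X](scaler0 _ k^-1) -(subrr v); apply: cvg_tvsZ; first exact: cvg_cst.
  by apply: cvg_tvsB; [exact: cvg_id|exact: cvg_cst].
move=> /(_ _ vB) wB; near=> w.
have kr' : `|k| < r by rewrite gtr0_norm.
have Bw : B (k^-1 *: (w - v)) by near: w.
have [_] := H v k (k^-1 *: (w - v)) Av kr' Bw.
rewrite gt_eqF// scalerA divff ?gt_eqF// scale1r subrKC d0 subr0 => /(_ isT).
have -> : `|k^-1 * (f w - f v)| = k^-1 * `|(f v : R) - f w|.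
  by rewrite distrC normrM gtr0_norm// invr_gt0.
rewrite -ltr_pdivlMl ?invr_gt0// invrK mulr1 => /lt_trans; exact.
Unshelve. all: by end_near. Qed.

(** Chain rule: [c (t + k)] is [c t] moved by [k] in the direction of the difference quotient of
    [c], which tends to [d]. *)
Lemma dlim_comp (c : R -> E) (t : R) (d : E) : U (c t) -> dlim (c : R^o -> E) t 1 d ->
  dlim (fun s : R^o => f (c s) : R^o) t 1 (ddir f (c t) d).
Proof.
move=> Uc cd; apply/dlimE.
have cd' := (dlimE _ _ _).1 cd.
have H : (fun k : R => k^-1 *: (f (c t + k *: (k^-1 *: (c (t + k) - c t))) - f (c t))) @ 0^' -->
    (ddir f (c t) d : R^o).
  by apply: cvg_quotient => //; exact: cvg_cst.
apply: cvg_near_eq H _; near=> k.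
have k0 : k != 0 by near: k; exact: nbhs_dnbhs_neq.
by rewrite scalerA divff// scale1r subrKC.
Unshelve. all: by end_near. Qed.

End StrictDifferentiability.

(** * Regularity of curves *)

Lemma dlim_scalev (R : realType) (V : tvsType R) (phi : R -> R) (x : R -> V) (t k : R) (d : V) :
  dlim (phi : R^o -> R^o) t 1 k -> dlim (x : R^o -> V) t 1 d ->
  dlim (fun s : R^o => phi s *: x s) t 1 (k *: x t + phi t *: d).
Proof.
move=> Hp Hx; have cx := dlim_continuous Hx.
move/dlimE : Hp => Hp; move/dlimE : Hx => Hx; apply/dlimE.
have xt : (fun h : R => x (t + h)) @ 0^' --> x t.
  have H0 : (fun h : R => t + h) @ (0 : R)^' --> t.
    suff: (fun h : R => t + h) @ (0 : R)^' --> t + 0 by rewrite addr0.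
    by apply: cvgD; [exact: cvg_cst|exact: nbhs_dnbhs].
  exact: (cvg_comp _ _ H0 cx).
pose proof (cvg_tvsD (cvg_tvsZ Hp xt) (cvg_tvsZ (@cvg_cst _ (phi t : R^o) _ 0^' _) Hx)) as H.
apply: cvg_near_eq H _; near=> h.
rewrite [X in _ + X = _]scalerA [phi t * _]mulrC -[X in _ + X = _]scalerA.
have -> : (h^-1 *: (phi (t + h) - phi t : R^o)) *: x (t + h) =
    h^-1 *: ((phi (t + h) - phi t) *: x (t + h)) by rewrite scalerA.
by rewrite -scalerDr scalerBl scalerBr addrA subrK.
Unshelve. all: by end_near. Qed.

Lemma dlim_pair (R : realType) (V W : tvsType R) (x : R -> V) (y : R -> W)
    (t : R) (d : V) (d' : W) :
  dlim (x : R^o -> V) t 1 d -> dlim (y : R^o -> W) t 1 d' ->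
  dlim (fun s : R^o => (x s, y s)) t 1 (d, d').
Proof. by move=> Hx Hy; apply: cvg_pair. Qed.

Section CurveRegularity.
Variables (R : realType) (V : tvsType R) (HV : hausdorff_space V).

Lemma dlim_dir (X : R -> V) (t : R) (d : V) (xi : R) : dlim (X : R^o -> V) t 1 d ->
  dlim (X : R^o -> V) t xi (xi *: d).
Proof.
move=> /dlimE H; rewrite /dlim.
have [->|xi0] := eqVneq xi 0.
  rewrite scale0r; apply: cvg_near_eq (@cvg_cst V 0 R 0^' _) _; near=> h.
  by rewrite scaler0 addr0 subrr scaler0.
have hxi : (fun h : R => h * xi) @ 0^' --> (0 : R)^'.
  move=> U /near_dnbhs0[r r0 HU]; apply/near_dnbhs0; exists (r / `|xi|).
    by rewrite divr_gt0 ?normr_gt0.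
  move=> h h0 hr; apply: HU; first by rewrite mulf_neq0.
  by rewrite normrM -ltr_pdivlMr ?normr_gt0.
pose proof (cvg_tvsZ (@cvg_cst _ (xi : R^o) _ 0^' _) (cvg_comp _ _ hxi H)) as H'.
apply: cvg_near_eq H' _; near=> h.
by rewrite /= scalerA invfM mulrCA divff// mulr1.
Unshelve. all: by end_near. Qed.

Arguments dlim_dir [X t d] xi _.

Lemma isC1_extension (U : set R^o) (X : R -> V) t : isC1 U (X : R^o -> V) -> U t ->
  dlim (X : R^o -> V) t 1 (ddir (X : R^o -> V) t 1) /\
  {for t, continuous (fun s : R => ddir (X : R^o -> V) s 1)}.
Proof.
move=> XC1 Ut; split; first exact: isC1_dlim XC1 Ut.
have H0 : (fun s : R => (s : R^o, 1 : R^o)) @ t --> (t : R^o, 1 : R^o).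
  by apply: (cvg_pair (G := nbhs (t : R^o)) (H := nbhs (1 : R^o))); [exact: cvg_id|exact: cvg_cst].
exact: (cvg_comp _ _ H0 (XC1.2 (t, 1) Ut)).
Qed.

Lemma isC1_curve (U : set R^o) (X X' : R -> V) : open U ->
  (forall t, U t -> dlim (X : R^o -> V) t 1 (X' t)) ->
  (forall t, U t -> {for t, continuous X'}) -> isC1 U (X : R^o -> V).
Proof.
move=> oU XX' X'c; split=> [t xi Ut|[t xi] /= Ut].
  by exists (xi *: X' t); exact/dlim_dir/XX'.
suff : (fun q : R^o * R^o => ddir (X : R^o -> V) q.1 q.2) @ (t, xi) --> xi *: X' t.
  by rewrite -(dlim_ddir HV (dlim_dir xi (XX' _ Ut))).
have H : (fun q : R^o * R^o => q.2 *: X' q.1) @ (t, xi) --> xi *: X' t.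
  apply: cvg_tvsZ; first exact: cvg_snd.
  have c1 : (fun q : R^o * R^o => q.1) @ (t, xi) --> (t : R^o) by exact: cvg_fst.
  exact: (cvg_comp _ _ c1 (X'c t Ut)).
apply: cvg_near_eq H _.
exists (U, setT) => /=; first by split; [exact: open_nbhs_nbhs|exact: filterT].
by move=> [s eta] [/= Us _]; rewrite (dlim_ddir HV (dlim_dir eta (XX' _ Us))).
Qed.

(** The first derivative is [xi *: X' t], linear in [xi]. As a function of [(t, xi)] its derivative
    along [(tau, sig)] is [sig *: X' t + (xi * tau) *: X'' t], visibly jointly continuous. *)
Lemma isC2_curve (U : set R^o) (X X' X'' : R -> V) : open U ->
  (forall t, U t -> dlim (X : R^o -> V) t 1 (X' t)) ->
  (forall t, U t -> dlim (X' : R^o -> V) t 1 (X'' t)) ->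
  (forall t, U t -> {for t, continuous X''}) -> isC2 U (X : R^o -> V).
Proof.
move=> oU XX' XX'' X''c.
have X'c t : U t -> {for t, continuous X'} by move=> /XX''; exact: dlim_continuous.
have XE t xi : U t -> ddir (X : R^o -> V) t xi = xi *: X' t.
  by move=> Ut; exact: (dlim_ddir HV (dlim_dir xi (XX' _ Ut))).
split; first exact: isC1_curve X'c.
have D (p q : R^o * R^o) : U p.1 ->
    dlim (fun q : R^o * R^o => ddir (X : R^o -> V) q.1 q.2) p q
      (q.2 *: X' p.1 + (p.2 * q.1) *: X'' p.1).
  case: p q => t xi [tau sig] /= Ut.
  have H0 : (fun h : R => t + h *: tau) @ (0 : R)^' --> (t : R^o).
    suff: (fun h : R => (t : R^o) + h *: tau) @ (0 : R)^' --> (t : R^o) + 0 *: tau.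
      by rewrite scale0r addr0.
    apply: cvg_tvsD; first exact: cvg_cst.
    by apply: cvg_tvsZ; [exact: nbhs_dnbhs|exact: cvg_cst].
  pose proof (cvg_tvsZ (@cvg_cst _ (sig : R^o) _ 0^' _) (cvg_comp _ _ H0 (X'c t Ut))) as H1.
  have := dlim_dir tau (XX'' _ Ut); rewrite /dlim => H2.
  pose proof (cvg_tvsZ (@cvg_cst _ (xi : R^o) _ 0^' _) H2) as H3.
  pose proof (cvg_tvsD H1 H3) as H4; rewrite scalerA in H4.
  rewrite /dlim; apply: cvg_near_eq H4 _.
  have nU : nbhs (t : R^o) U by exact: open_nbhs_nbhs.
  near=> h; have h0 : h != 0 by near: h; exact: nbhs_dnbhs_neq.
  have Uh : U (t + h *: tau) by near: h; exact: (H0 U nU).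
  rewrite /= !XE//; set A := X' (t + h *: tau); set B := X' t.
  have -> : (xi + h *: sig) *: A - xi *: B = xi *: (A - B) + h *: (sig *: A).
    by rewrite scalerDl scalerBr addrAC scalerA.
  rewrite [RHS]scalerDr addrC; congr (_ + _); first by rewrite !scalerA mulrC.
  by rewrite scalerA mulVf// scale1r.
split=> [[t xi] v /= [Ut _]|[[t xi] [tau sig]] /= [Ut _]].
  by eexists; exact: (D (t, xi) v Ut).
suff : (fun z : (R^o * R^o) * (R^o * R^o) =>
      ddir (fun q : R^o * R^o => ddir (X : R^o -> V) q.1 q.2) z.1 z.2) @ ((t, xi), (tau, sig)) -->
    sig *: X' t + (xi * tau) *: X'' t.
  by have /= <- := dlim_ddir HV (D (t, xi) (tau, sig) Ut).
have H : (fun z : (R^o * R^o) * (R^o * R^o) => z.2.2 *: X' z.1.1 + (z.1.2 * z.2.1) *: X'' z.1.1)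
    @ ((t, xi), (tau, sig)) --> sig *: X' t + (xi * tau) *: X'' t.
  have c11 : (fun z : (R^o * R^o) * (R^o * R^o) => z.1.1) @ ((t, xi), (tau, sig)) --> t.
    exact: cvg_comp (@cvg_fst _ _ _ _ _) (@cvg_fst _ _ _ _ _).
  apply: cvg_tvsD; apply: cvg_tvsZ.
  - exact: cvg_comp (@cvg_snd _ _ _ _ _) (@cvg_snd _ _ _ _ _).
  - exact: (cvg_comp _ _ c11 (X'c t Ut)).
  - apply: (@cvg_tvsZ R R^o).
      exact: cvg_comp (@cvg_fst _ _ _ _ _) (@cvg_snd _ _ _ _ _).
    exact: cvg_comp (@cvg_snd _ _ _ _ _) (@cvg_fst _ _ _ _ _).
  - exact: (cvg_comp _ _ c11 (X''c t Ut)).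
apply: cvg_near_eq H _.
exists (U `*` setT, setT) => /=.
  split; last exact: filterT.
  by exists (U, setT) => //=; split; [exact: open_nbhs_nbhs|exact: filterT].
by move=> [[s eta] v] [/= [Us _] _]; rewrite (dlim_ddir HV (D (s, eta) v Us)).
Unshelve. all: by end_near. Qed.

End CurveRegularity.
Arguments dlim_dir {R V X t d} xi _.

(** * Integrals over a segment *)

(* Composing with [clamp a b] extends a curve on [a, b] to all of [R]; this yields
   primitives on a neighbourhood of [a, b], as required by [curveC1]. *)
Definition clamp (R : realType) (a b t : R) : R := Num.max a (Num.min b t).

Lemma clamp_id (R : realType) (a b t : R) : a <= t <= b -> clamp a b t = t.
Proof. by move=> /andP[at_ tb]; rewrite /clamp min_r// max_r. Qed.

Lemma clamp_in (R : realType) (a b t : R) : a < b -> a <= clamp a b t <= b.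
Proof. by move=> ab; rewrite /clamp le_max lexx ge_max ge_min lexx (ltW ab). Qed.

Lemma clamp_continuous (R : realType) (a b : R) : continuous (clamp a b).
Proof.
move=> t; apply: (@continuous_max R R (fun=> a) (fun s => Num.min b s)); first exact: cvg_cst.
by apply: (@continuous_min R R (fun=> b) id); [exact: cvg_cst|exact: cvg_id].
Qed.

Lemma clamp_comp_continuous (R : realType) (V : tvsType R) (a b : R) (f : R -> V) t : a < b ->
  (forall t, a <= t <= b -> {for t, continuous f}) ->
  {for t, continuous (fun s => f (clamp a b s))}.
Proof.
move=> ab fc; apply: (cvg_comp _ _ (@clamp_continuous R a b t)).
by apply: fc; exact: clamp_in.
Qed.

(** The unit margin provides an open neighbourhood of [[a, b]] on which the primitive is
    differentiable. *)
Lemma primitive_clamp (R : realType) (V : tvsType R) (HVc : seq_complete V) (a b : R)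
    (f : R -> V) : a < b -> (forall t, a <= t <= b -> {for t, continuous f}) ->
  exists F : R -> V, forall t, a - 1 < t < b + 1 -> dlim (F : R^o -> V) t 1 (f (clamp a b t)).
Proof.
move=> ab fc; apply: (@primitive_exists _ _ HVc (fun t => f (clamp a b t))); first lra.
by move=> t _; exact: clamp_comp_continuous.
Qed.

Section RealIntegrals.
Variables (R : realType) (a b : R) (hab : a < b).
Implicit Types f : R -> R.

Lemma continuous_integrable f : (forall t, a <= t <= b -> {for t, continuous f}) ->
  (@lebesgue_measure R).-integrable `[a, b] (EFin \o f).
Proof.
move=> fc; apply: continuous_compact_integrable; first exact: segment_compact.
exact: continuous_subsegment.
Qed.

Lemma le_norm_Rintegral f e : (forall t, a <= t <= b -> {for t, continuous f}) ->
  (forall t, a <= t <= b -> `|f t| <= e) ->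
  `|\int[@lebesgue_measure R]_(t in `[a, b]) f t| <= e * (b - a).
Proof.
move=> fc fe; apply: le_trans (le_normr_Rintegral _ (continuous_integrable fc)) _.
  exact: measurable_itv.
have -> : e * (b - a) = \int[@lebesgue_measure R]_(t in `[a, b]) (fun=> e) t.
  rewrite Rintegral_cst//; congr (_ * _); have := lebesgue_measure_itv `[a, b].
  by rewrite /= lte_fin hab -EFinB => /(congr1 fine)/= <-.
apply: le_Rintegral => //.
- by apply: continuous_integrable => t /fc tc; apply: cvg_comp tc _; exact: norm_continuous.
- by apply: continuous_integrable => t _; exact: cvg_cst.
Qed.

(** With [kap] a primitive of [K], integration by parts makes [P - kap] orthogonal to every [phi']
    of mean zero, hence constant. The derivative is asserted of [kappa], as [P] is only known to
    agree with it on [[a, b]]. *)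
Lemma du_bois_reymond (P K : R -> R) :
  (forall t, a <= t <= b -> {for t, continuous P}) ->
  (forall t, a <= t <= b -> {for t, continuous K}) ->
  (forall phi phi' : R -> R,
    (forall t, a - 1 < t < b + 1 -> dlim (phi : R^o -> R^o) t 1 (phi' t)) ->
    (forall t, a - 1 < t < b + 1 -> {for t, continuous phi'}) ->
    phi a = 0 -> phi b = 0 ->
    \int[@lebesgue_measure R]_(t in `[a, b]) (phi' t * P t + phi t * K t) = 0) ->
  exists2 kappa : R -> R, forall t, a <= t <= b -> dlim (kappa : R^o -> R^o) t 1 (K t) &
    forall t, a <= t <= b -> P t = kappa t.
Proof.
move=> Pc Kc H.
have prim (f : R -> R^o) := @primitive_clamp R R^o (@seq_complete_regular R) a b f hab.
have ext t : a <= t <= b -> a - 1 < t < b + 1 by move=> /andP[? ?]; apply/andP; split; lra.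
have aI : a <= a <= b by rewrite lexx ltW.
have bI : a <= b <= b by rewrite lexx ltW.
have [kap kapK] := prim K Kc.
have kapc t : a <= t <= b -> {for t, continuous kap}.
  by move=> tab; exact: dlim_continuous (kapK t (ext t tab)).
have fc t : a <= t <= b -> {for t, continuous (fun t => P t - kap t)}.
  by move=> tab; apply: cvgB; [exact: Pc|exact: kapc].
have [F Ff] := prim _ fc.
(* [phi' = P - kap - m] on [a, b], so that [phi'^2] has the same integral over [a, b] as
   [phi' P + phi K], namely 0 *)
pose m := (F b - F a) / (b - a).
pose phi t := F t - F a - m * (t - a).
pose phi' t := P (clamp a b t) - kap (clamp a b t) - m.
have phiE t : a - 1 < t < b + 1 -> dlim (phi : R^o -> R^o) t 1 (phi' t).
  move=> tab; have id1 : dlim (fun s : R^o => s - a : R^o) t 1 1.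
    rewrite -[X in dlim _ _ _ X]subr0; apply: dlimB (dlim_cst _ _).
    apply/dlimE; apply: cvg_near_eq (@cvg_cst R^o 1 R 0^' _) _; near=> h.
    rewrite addrAC subrr add0r /GRing.scale/= mulVf//; near: h; exact: nbhs_dnbhs_neq.
  have := dlimB (dlimB (Ff t tab) (dlim_cst (F a : R^o) t)) (dlimZ m id1).
  by rewrite subr0 (mulr1 m : m *: (1 : R^o) = m).
have phi'c t : {for t, continuous phi'}.
  apply: cvgB; last exact: cvg_cst.
  exact: (@clamp_comp_continuous R R^o a b (fun t => P t - kap t) t hab fc).
have phia : phi a = 0 by rewrite /phi !subrr mulr0 subrr.
have phib : phi b = 0 by rewrite /phi /m divfK ?subrr// subr_eq0 gt_eqF.
have phi'E t : a <= t <= b -> phi' t = P t - kap t - m by move=> tab; rewrite /phi' clamp_id.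
have /prim[S SE] : forall t, a <= t <= b -> {for t, continuous (fun t => phi' t * phi' t : R^o)}.
  by move=> t _; apply: cvgM; exact: phi'c.
have {}SE t : a <= t <= b -> dlim (S : R^o -> R^o) t 1 (phi' t * phi' t).
  by move=> tab; have := SE t (ext t tab); rewrite clamp_id.
(* [phi' * P + phi * K] is [phi' * phi'] plus the derivative of [m * phi + phi * kap], a function
   that vanishes at [a] and [b]. *)
have SS : S b - S a = 0.
  have <- := H phi phi' phiE (fun t _ => phi'c t) phia phib.
  rewrite (@real_FTC2 _ (fun t => S t + (m * phi t + phi t * kap t)) _ a b hab).
  - by rewrite phia phib !mulr0 !mul0r !addr0.
  - move=> t tab; have phic := dlim_continuous (phiE t (ext t tab)).
    apply: cvgD; first by apply: cvgM; [exact: phi'c|exact: Pc].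
    by apply: cvgM; [exact: phic|exact: Kc].
  - move=> t tab; have pE := phiE t (ext t tab).
    have kE := kapK t (ext t tab); rewrite clamp_id// in kE.
    have := dlimD (SE t tab) (dlimD (dlimZ m pE) (dlim_scalev pE kE)).
    rewrite /GRing.scale/=.
    by congr dlim; rewrite phi'E//; ring.
(* [S] is nondecreasing with equal end values, hence constant on [[a, b]], so its derivative
   [phi' * phi'] vanishes there. *)
have Smono s t : a <= s -> s <= t -> t <= b -> S s <= S t.
  move=> as_ st tb; have [->//|nst] := eqVneq s t.
  have lst : s < t by rewrite lt_neqAle nst.
  have [|c cst Hc] := real_MVT (F := S) lst (f := fun t => phi' t * phi' t).
    by move=> r /andP[sr rt]; apply: SE; rewrite (le_trans as_ sr) (le_trans rt tb).
  by rewrite -subr_ge0 Hc mulr_ge0 ?subr_ge0// -expr2 sqr_ge0.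
have Scst t : a <= t <= b -> S t = S a.
  move=> /andP[at_ tb]; apply/eqP; rewrite eq_le [S a <= S t]Smono// andbT.
  by move/eqP: SS; rewrite subr_eq0 => /eqP <-; rewrite Smono.
have phi'0 t : a <= t <= b -> phi' t = 0.
  move=> tab; suff : phi' t * phi' t = 0 by move=> /eqP; rewrite mulf_eq0 orbb => /eqP.
  rewrite -(cder_dlim hab (@norm_hausdorff _ R^o) Scst tab (dlim_cst (S a : R^o) t)).
  exact/esym/(cder_dlim hab (@norm_hausdorff _ R^o) (fun _ _ => erefl) tab (SE t tab)).
exists (fun t => kap t + m) => t tab.
  have kE := kapK t (ext t tab); rewrite clamp_id// in kE.
  by rewrite -[K t]addr0; exact: dlimD kE (dlim_cst (m : R^o) t).
by have := phi'0 t tab; rewrite phi'E// => /eqP; rewrite subr_eq0 subr_eq => /eqP ->; rewrite addrC.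
Unshelve. all: by end_near. Qed.

(** Differentiation under the integral sign: strict differentiability and compactness make the
    difference quotients converge uniformly in [t]. *)
Lemma integral_dlim (E : tvsType R) (U : set E) (f : E -> R^o) (c d : R -> E) :
  open U -> isC1 U f ->
  (forall t, a <= t <= b -> U (c t)) ->
  (forall t, a <= t <= b -> {for t, continuous c}) ->
  (forall t, a <= t <= b -> {for t, continuous d}) ->
  (fun s : R => s^-1 * (\int[@lebesgue_measure R]_(t in `[a, b]) f (c t + s *: d t)
                      - \int[@lebesgue_measure R]_(t in `[a, b]) f (c t))) @ 0^'
  --> (\int[@lebesgue_measure R]_(t in `[a, b]) ddir f (c t) (d t))%R.
Proof.
move=> oU fC1 Uc cc dc.
have Dc t : a <= t <= b -> {for t, continuous (fun t => ddir f (c t) (d t) : R^o)}.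
  move=> tab; have H0 : (fun t => (c t, d t)) @ t --> (c t, d t).
    by apply: (cvg_pair (G := nbhs (c t)) (H := nbhs (d t))); [exact: cc|exact: dc].
  exact: (cvg_comp _ _ H0 (fC1.2 (c t, d t) (Uc t tab))).
have fcc t : a <= t <= b -> {for t, continuous (fun t => f (c t))}.
  move=> tab; apply: (cvg_comp _ _ (cc t tab)).
  by apply: (isC1_continuous oU fC1); exact: Uc.
apply/cvgrPdist_lt => e e0.
pose e' := e / (2 * (b - a)).
have ba0 : 0 < b - a by rewrite subr_gt0.
have e'0 : 0 < e' by rewrite divr_gt0// mulr_gt0.
have e'20 : 0 < e' / 2 by rewrite divr_gt0.
have unif : \forall s \near (0 : R)^', forall t, a <= t <= b -> U (c t + s *: d t) /\
    `|s^-1 * (f (c t + s *: d t) - f (c t)) - ddir f (c t) (d t)| <= e'.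
  apply: segment_near => t tab.
  have [r [A [B [r0 cA dB H]]]] := strict_diff oU fC1 (d t) (Uc t tab) e'20.
  have /cvgrPdist_lt/(_ _ e'20) nD := Dc t tab.
  have nA : \forall t' \near t, A (c t') := cc t tab A cA.
  have nB : \forall t' \near t, B (d t') := dc t tab B dB.
  (* [strict_diff] compares the quotients at [t'] with the derivative at the fixed [t]; continuity
     replaces it by the derivative at [t'], each step costing [e' / 2]. *)
  exists ([set t' | A (c t') /\ B (d t') /\
            `|(ddir f (c t) (d t) : R^o) - ddir f (c t') (d t')| < e' / 2],
          [set s | s != 0 /\ `|s| < r]) => /=.
    split => /=; last by apply/near_dnbhs0; exists r.
    by near=> t'; split; [near: t'|split; near: t'].
  move=> [t' s] /= [[At [Bt Dt]] [s0 sr]].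
  have [Us Hs] := H (c t') s (d t') At sr Bt; split => //.
  have := Hs s0; set q := _ * _; set D := ddir f (c t) (d t) in Dt *; set D' := ddir f _ _ in Dt *.
  move=> Hq; have -> : q - D' = (q - D) + (D - D') by ring.
  by rewrite (le_trans (ler_normD _ _))// [e']splitr ltW// ltrD.
near=> s.
have s0 : s != 0 by near: s; exact: nbhs_dnbhs_neq.
have Hs : forall t, a <= t <= b -> U (c t + s *: d t) /\
    `|s^-1 * (f (c t + s *: d t) - f (c t)) - ddir f (c t) (d t)| <= e' by near: s.
have fsc t : a <= t <= b -> {for t, continuous (fun t => f (c t + s *: d t))}.
  move=> tab; have H0 : (fun t => c t + s *: d t) @ t --> c t + s *: d t.
    exact: (cvg_tvsD (cc t tab) (cvg_tvsZ (cvg_cst (s : R^o)) (dc t tab))).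
  exact: (cvg_comp _ _ H0 (isC1_continuous oU fC1 (Hs t tab).1)).
rewrite distrC -RintegralB//; try exact: continuous_integrable.
rewrite -RintegralZl//; last first.
  by apply: continuous_integrable => t tab; apply: cvgB; [exact: fsc|exact: fcc].
have qc t : a <= t <= b -> {for t, continuous (fun t => s^-1 * (f (c t + s *: d t) - f (c t)))}.
  by move=> tab; apply: cvgM; [exact: cvg_cst|apply: cvgB; [exact: fsc|exact: fcc]].
rewrite -RintegralB//; try exact: continuous_integrable.
apply: le_lt_trans (le_norm_Rintegral (e := e') _ _) _.
- by move=> t tab; apply: cvgB; [exact: qc|exact: Dc].
- by move=> t /Hs[].
have -> : e' * (b - a) = e / 2 by rewrite /e'; field; lra.
by rewrite gtr_pMr// invf_lt1 ?ltr1n.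
Unshelve. all: by end_near. Qed.

End RealIntegrals.

(** * The Levi-Civita connection and the first variation of energy *)

Section Metric.
Variables (R : realType) (V : tvsType R) (HV : hausdorff_space V) (Om : set V) (HOm : open Om).
Variables (g : V -> V -> V -> R) (A : V -> V -> V -> V).
Hypotheses (Hg : riemannian_metric Om g) (Hg1 : metric_C1 Om g) (HA : levi_civita Om g A).

Let U : set (V * V * V) := Om `*` setT `*` setT.
Let G (p : V * V * V) : R^o := g p.1.1 p.1.2 p.2.

Let openU : open U := open_setXT (open_setXT HOm).

Lemma metric_sym v p q : Om v -> g v p q = g v q p.
Proof. by move=> Ov; have [] := Hg Ov. Qed.

Lemma metric_linl v c p p' q : Om v -> g v (c *: p + p') q = c * g v p q + g v p' q.
Proof. by move=> Ov; have [_ []] := Hg Ov. Qed.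

Lemma metricDl v p p' q : Om v -> g v (p + p') q = g v p q + g v p' q.
Proof. by move=> Ov; rewrite -[p]scale1r metric_linl// mul1r scale1r. Qed.

Lemma metric0l v q : Om v -> g v 0 q = 0.
Proof. by move=> Ov; apply: (@addrI _ (g v 0 q)); rewrite -metricDl// !addr0. Qed.

Lemma metricZl v c p q : Om v -> g v (c *: p) q = c * g v p q.
Proof. by move=> Ov; rewrite -[c *: p]addr0 metric_linl// metric0l// addr0. Qed.

Lemma metricDr v p q q' : Om v -> g v p (q + q') = g v p q + g v p q'.
Proof. by move=> Ov; rewrite !(metric_sym p)// metricDl. Qed.

Lemma metricZr v c p q : Om v -> g v p (c *: q) = c * g v p q.
Proof. by move=> Ov; rewrite !(metric_sym p)// metricZl. Qed.

Lemma metric0r v p : Om v -> g v p 0 = 0.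
Proof. by move=> Ov; rewrite metric_sym// metric0l. Qed.

Lemma metricNr v p q : Om v -> g v p (- q) = - g v p q.
Proof. by move=> Ov; rewrite -scaleN1r metricZr// mulN1r. Qed.

Lemma metric_eq0 v p : Om v -> (forall w, g v p w = 0) -> p = 0.
Proof.
move=> Ov H; apply/eqP; apply/negPn/negP => p0.
by have [_ [_ /(_ p p0)]] := Hg Ov; rewrite H ltxx.
Qed.

Lemma cvg_metric (T : Type) (F : set_system T) {FF : Filter F} (v p q : T -> V) (v0 p0 q0 : V) :
  Om v0 -> v @ F --> v0 -> p @ F --> p0 -> q @ F --> q0 ->
  (fun t => g (v t) (p t) (q t)) @ F --> g v0 p0 q0.
Proof.
move=> Ov vF pF qF.
have Gc : {for ((v0, p0), q0), continuous G}.
  exact: (isC1_continuous openU Hg1 (v := ((v0, p0), q0)) (conj (conj Ov I) I)).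
have H : (fun t => ((v t, p t), q t)) @ F --> ((v0, p0), q0).
  apply: (cvg_pair (G := nbhs (v0, p0)) (H := nbhs q0)) => //.
  exact: (cvg_pair (G := nbhs v0) (H := nbhs p0)).
exact: (cvg_comp _ _ H Gc).
Qed.

Lemma cvg_christoffel (T : Type) (F : set_system T) {FF : Filter F} (v p q : T -> V)
    (v0 p0 q0 : V) :
  Om v0 -> v @ F --> v0 -> p @ F --> p0 -> q @ F --> q0 ->
  (fun t => A (v t) (p t) (q t)) @ F --> A v0 p0 q0.
Proof.
move=> Ov vF pF qF; have [_ [_ [Ac _]]] := HA.
have H : (fun t => ((v t, p t), q t)) @ F --> ((v0, p0), q0).
  apply: (cvg_pair (G := nbhs (v0, p0)) (H := nbhs q0)) => //.
  exact: (cvg_pair (G := nbhs v0) (H := nbhs p0)).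
exact: (cvg_comp _ _ H (Ac ((v0, p0), q0) Ov)).
Qed.

Lemma christoffel_sym v p q : Om v -> A v p q = A v q p.
Proof. by move=> Ov; have [_ [_ [_ [Asym _]]]] := HA; exact: Asym. Qed.

Lemma christoffelZ v p c q : Om v -> A v p (c *: q) = c *: A v p q.
Proof.
move=> Ov; have [/(_ v p Ov)[Alin _] _] := HA.
have A0 : A v p 0 = 0.
  by have := Alin (- 1) 0 0; rewrite scaler0 add0r scaleN1r addNr.
by rewrite -[c *: q]addr0 Alin A0 addr0.
Qed.

(** Metric compatibility is tested on constant vector fields, for which the covariant derivative is
    [A] alone. *)
Lemma metric_christoffel v xi p q : Om v ->
  (fun t : R => t^-1 * (g (v + t *: xi) p q - g v p q)) @ 0^' -->
    g v (A v xi p) q + g v p (A v xi q).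
Proof.
move=> Ov; have [_ [_ [_ [_ Acomp]]]] := HA.
have c0 (w : V) v' xi' : dlim (fun _ : V => w) v' xi' 0.
  rewrite /dlim; apply: cvg_near_eq (@cvg_cst V 0 R 0^' _) _; near=> h.
  by rewrite subrr scaler0.
have d0 (w : V) v' xi' : ddir (fun _ : V => w) v' xi' = 0 := dlim_ddir HV (c0 w v' xi').
have C1 (w : V) : isC1 Om (fun _ : V => w).
  split=> [v' xi' _|z _]; first by exists 0; exact: c0.
  have -> : (fun z : V * V => ddir (fun _ : V => w) z.1 z.2) = (fun=> 0).
    by apply/funext => z'; rewrite d0.
  exact: cvg_cst.
by have := Acomp xi (fun=> p) (fun=> q) (C1 p) (C1 q) v Ov; rewrite !d0 !add0r.
Unshelve. all: by end_near. Qed.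

Lemma ddir_metric v p q xi eta zeta : Om v ->
  ddir G ((v, p), q) ((xi, eta), zeta) =
  g v (A v xi p) q + g v p (A v xi q) + g v eta q + g v p zeta.
Proof.
move=> Ov; apply: dlim_ddir; first exact: norm_hausdorff.
rewrite /dlim.
have H0 : (fun h : R => v + h *: xi) @ (0 : R)^' --> v.
  suff: (fun h : R => v + h *: xi) @ (0 : R)^' --> v + (0 : R) *: xi by rewrite scale0r addr0.
  apply: cvg_tvsD; first exact: cvg_cst.
  by apply: cvg_tvsZ; [exact: nbhs_dnbhs|exact: cvg_cst].
have cst (w : V) : (fun _ : R => w) @ (0 : R)^' --> w by exact: cvg_cst.
have H1 := @metric_christoffel v xi p q Ov.
pose proof (cvg_metric Ov H0 (cst eta) (cst q)) as H2.
pose proof (cvg_metric Ov H0 (cst p) (cst zeta)) as H3.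
(* The term of second order in the bilinear expansion, which disappears in the limit. *)
have H4 : (fun h : R => h * g (v + h *: xi) eta zeta) @ (0 : R)^' --> 0 * g v eta zeta.
  by apply: cvgM; [exact: nbhs_dnbhs|exact: cvg_metric].
rewrite mul0r in H4; rewrite -[X in _ --> X]addr0.
apply: cvg_near_eq (cvgD (cvgD (cvgD H1 H2) H3) H4) _.
near=> h; have h0 : h != 0 by near: h; exact: nbhs_dnbhs_neq.
have Oh : Om (v + h *: xi) by near: h; exact: (H0 _ (open_nbhs_nbhs (conj HOm Ov))).
move: Oh; set w := v + h *: xi => Oh.
rewrite -[LHS]/(h^-1 * (g w p q - g v p q) + g w eta q + g w p zeta + h * g w eta zeta).
rewrite -[RHS]/(h^-1 * (g w (p + h *: eta) (q + h *: zeta) - g v p q)).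
by rewrite metricDl// !metricDr// !metricZl// !metricZr//; field.
Unshelve. all: by end_near. Qed.

Lemma dlim_metric (x p q : R -> V) (t : R) (x' p' q' : V) : Om (x t) ->
  dlim (x : R^o -> V) t 1 x' -> dlim (p : R^o -> V) t 1 p' -> dlim (q : R^o -> V) t 1 q' ->
  dlim (fun s : R^o => g (x s) (p s) (q s) : R^o) t 1
    (g (x t) (A (x t) x' (p t) + p') (q t) + g (x t) (p t) (A (x t) x' (q t) + q')).
Proof.
move=> Ox Hx Hp Hq.
have H := dlim_comp openU Hg1 (c := fun s => ((x s, p s), q s)) _ (dlim_pair (dlim_pair Hx Hp) Hq).
have {}H := H (conj (conj Ox I) I).
rewrite ddir_metric// in H.
rewrite metricDl// metricDr//.
have -> : g (x t) (A (x t) x' (p t)) (q t) + g (x t) p' (q t) +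
   (g (x t) (p t) (A (x t) x' (q t)) + g (x t) (p t) q') =
   g (x t) (A (x t) x' (p t)) (q t) + g (x t) (p t) (A (x t) x' (q t)) +
   g (x t) p' (q t) + g (x t) (p t) q'.
  by ring.
exact: H.
Qed.

(** * First variation along a curve [x] with a differentiable extension [X] *)

Variables (a b : R) (hab : a < b) (x X X' : R -> V).
Hypotheses (xOm : forall t, a <= t <= b -> Om (x t)) (xX : forall t, a <= t <= b -> x t = X t)
  (XX' : forall t, a <= t <= b -> dlim (X : R^o -> V) t 1 (X' t))
  (X'c : forall t, a <= t <= b -> {for t, continuous X'}).

Let XOm t : a <= t <= b -> Om (X t).
Proof. by move=> tab; rewrite -xX//; exact: xOm. Qed.

Let Xc t : a <= t <= b -> {for t, continuous X}.
Proof. by move=> /XX'; exact: dlim_continuous. Qed.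

Let cvg_curve (p q : R -> V) t : a <= t <= b -> {for t, continuous p} -> {for t, continuous q} ->
  {for t, continuous (fun t => g (X t) (p t) (q t))}.
Proof. by move=> tab pc qc; apply: cvg_metric => //; [exact: XOm|exact: Xc]. Qed.

Let cvg_acc (p : R -> V) t : a <= t <= b -> {for t, continuous p} ->
  {for t, continuous (fun t => A (X t) (X' t) (p t))}.
Proof.
move=> tab pc; apply: cvg_christoffel => //; [exact: XOm|exact: Xc|exact: X'c].
Qed.

Lemma energy_derivative (y Y Y' : R -> V) :
  (forall t, a <= t <= b -> y t = Y t) ->
  (forall t, a <= t <= b -> dlim (Y : R^o -> V) t 1 (Y' t)) ->
  (forall t, a <= t <= b -> {for t, continuous Y'}) ->
  (fun s : R => s^-1 * (energy g a b (fun t => x t + s *: y t) - energy g a b x)) @ 0^' -->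
  \int[@lebesgue_measure R]_(t in `[a, b]) g (X t) (X' t) (A (X t) (X' t) (Y t) + Y' t).
Proof.
move=> yY YY' Y'c.
pose c t := ((X t, X' t), X' t); pose d t := ((Y t, Y' t), Y' t).
have pairc (u w : R -> V) t : {for t, continuous u} -> {for t, continuous w} ->
    {for t, continuous (fun t => ((u t, w t), w t))}.
  move=> uc wc; apply: (cvg_pair (G := nbhs (u t, w t)) (H := nbhs (w t))) => //.
  exact: (cvg_pair (G := nbhs (u t)) (H := nbhs (w t))).
have cc t : a <= t <= b -> {for t, continuous c}.
  by move=> tab; apply: pairc; [exact: Xc|exact: X'c].
have dc t : a <= t <= b -> {for t, continuous d}.
  by move=> tab; apply: pairc; [exact: dlim_continuous (YY' t tab)|exact: Y'c].
have Uc t : a <= t <= b -> U (c t) by move=> tab; split => //; split => //; exact: XOm.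
have H := integral_dlim hab openU Hg1 Uc cc dc.
have in01 t : `[a, b]%classic t -> a <= t <= b by rewrite /= in_itv.
have Es s : energy g a b (fun t => x t + s *: y t) =
    2^-1 * \int[@lebesgue_measure R]_(t in `[a, b]) G (c t + s *: d t).
  congr (_ * _); apply: eq_Rintegral => t /set_mem/in01 tab.
  have -> : cder a b (fun t => x t + s *: y t) t = X' t + s *: Y' t.
    apply: (@cder_dlim _ _ _ _ hab HV _ (fun t => X t + s *: Y t)) => //.
      by move=> r rab; rewrite xX// yY.
    exact: dlimD (XX' tab) (dlimZ s (YY' t tab)).
  by rewrite xX// yY.
have E0 : energy g a b x = 2^-1 * \int[@lebesgue_measure R]_(t in `[a, b]) G (c t).
  congr (_ * _); apply: eq_Rintegral => t /set_mem/in01 tab.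
  by rewrite (@cder_dlim _ _ _ _ hab HV _ X t (X' t))// ?xX//; exact: XX'.
(* Symmetry of [A] turns [A (X t) (Y t) (X' t)] into [A (X t) (X' t) (Y t)]; symmetry of [g] then
   gives two equal terms, and the 2 cancels the factor [2^-1] of the energy. *)
have DE t : a <= t <= b -> ddir G (c t) (d t) =
    2 * g (X t) (X' t) (A (X t) (X' t) (Y t) + Y' t).
  move=> tab; have Ot := XOm tab; rewrite ddir_metric// metricDr// (christoffel_sym (X' t))//.
  rewrite (metric_sym (A _ _ _))// (metric_sym (Y' t))//; ring.
have -> : \int[@lebesgue_measure R]_(t in `[a, b]) g (X t) (X' t) (A (X t) (X' t) (Y t) + Y' t) =
    2^-1 * \int[@lebesgue_measure R]_(t in `[a, b]) ddir G (c t) (d t).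
  rewrite -RintegralZl//; last first.
    apply: continuous_integrable => t tab.
    have H0 : (fun t => (c t, d t)) @ t --> (c t, d t).
      by apply: (cvg_pair (G := nbhs (c t)) (H := nbhs (d t))); [exact: cc|exact: dc].
    exact: (cvg_comp _ _ H0 (Hg1.2 (c t, d t) (Uc t tab))).
  by apply: eq_Rintegral => t /set_mem/in01 tab; rewrite DE// mulKf.
apply: cvg_near_eq (cvgM (cvg_cst (2^-1 : R)) H) _.
by near=> s; rewrite Es E0 -mulrBr [RHS]mulrCA.
Unshelve. all: by end_near. Qed.

Hypothesis crit : energy_critical g a b x.

(** For the variation [phi t *: w] the integrand is [phi'] times [g (X t) (X' t) w] plus [phi] times
    [g (X t) (X' t) (A (X t) (X' t) w)], the form treated by [du_bois_reymond]. *)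
Lemma euler_lagrange (w : V) : exists2 kappa : R -> R,
  forall t, a <= t <= b ->
    dlim (kappa : R^o -> R^o) t 1 (g (X t) (X' t) (A (X t) (X' t) w)) &
  forall t, a <= t <= b -> g (X t) (X' t) w = kappa t.
Proof.
have wc t : {for t, continuous (fun _ : R => w)} by exact: cvg_cst.
apply: (du_bois_reymond hab) => [t tab|t tab|phi phi' phiE phi'c phia phib].
- by apply: cvg_curve => //; exact: X'c.
- by apply: cvg_curve => //; [exact: X'c|exact: cvg_acc].
have ext t : a <= t <= b -> a - 1 < t < b + 1 by move=> /andP[? ?]; apply/andP; split; lra.
have yE t : a - 1 < t < b + 1 -> dlim (fun s : R^o => phi s *: w) t 1 (phi' t *: w).
  by move=> tab; exact: dlim_scale (phiE t tab).
have y'c t : a - 1 < t < b + 1 -> {for t, continuous (fun s : R => phi' s *: w)}.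
  by move=> tab; exact: (cvg_tvsZ (phi'c t tab) (wc t)).
have yC1 : curveC1 a b setT (fun t => phi t *: w).
  split=> //; exists `]a - 1, b + 1[%classic; split; first exact: interval_open.
  split; first by move=> t /= /ext; rewrite in_itv.
  exists (fun t => phi t *: w); split => //.
  apply: (@isC1_curve _ _ HV _ _ (fun t => phi' t *: w)); first exact: interval_open.
    by move=> t /=; rewrite in_itv/=; exact: yE.
  by move=> t /=; rewrite in_itv/=; exact: y'c.
have ya : phi a *: w = 0 by rewrite phia scale0r.
have yb : phi b *: w = 0 by rewrite phib scale0r.
have H := crit yC1 ya yb.
have H' := energy_derivative (fun t _ => erefl) (fun t tab => yE t (ext t tab))
   (fun t tab => y'c t (ext t tab)).
rewrite -[RHS](cvg_unique (@norm_hausdorff _ R^o) H' H).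
apply: eq_Rintegral => t /set_mem/=; rewrite in_itv/= => tab.
by have Ot := XOm tab; rewrite metricDr// christoffelZ// !metricZr// addrC.
Qed.

End Metric.

(** * Critical curves and geodesics *)

Section CurveExtensions.
Variables (R : realType) (V : tvsType R) (a b : R) (Om : set V) (x : R -> V).

Lemma curveC1_extension : curveC1 a b Om x ->
  exists X X' : R -> V, [/\ forall t, a <= t <= b -> x t = X t,
    forall t, a <= t <= b -> dlim (X : R^o -> V) t 1 (X' t) &
    forall t, a <= t <= b -> {for t, continuous X'}].
Proof.
move=> [_ [U [oU [abU [y [yC1 yx]]]]]].
exists y, (fun t => ddir y t 1); split=> t tab.
- by rewrite yx.
- exact: (isC1_extension yC1 (abU t tab)).1.
- exact: (isC1_extension yC1 (abU t tab)).2.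
Qed.

Lemma curveC2_extension : curveC2 a b Om x ->
  exists X X' X'' : R -> V, [/\ forall t, a <= t <= b -> x t = X t,
    forall t, a <= t <= b -> dlim (X : R^o -> V) t 1 (X' t),
    forall t, a <= t <= b -> dlim (X' : R^o -> V) t 1 (X'' t) &
    forall t, a <= t <= b -> {for t, continuous X''}].
Proof.
move=> [_ [U [oU [abU [y [[yC1 yC2] yx]]]]]].
exists y, (fun t => ddir y t 1).
(* The iterated derivative lives on pairs [(t, xi)]; the second derivative of the curve is its
   derivative at [(t, 1)] along [(1, 0)]. *)
exists (fun t => ddir (fun q : R^o * R^o => ddir y q.1 q.2) (t, 1) (1, 0)); split=> t tab.
- by rewrite yx.
- exact: (isC1_extension yC1 (abU t tab)).1.
- have H := isC1_dlim (v := ((t : R^o), (1 : R^o))) (xi := ((1 : R^o), (0 : R^o)))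
    yC2 (conj (abU t tab) I).
  rewrite /dlim in H *; apply: cvg_near_eq H _; near=> h.
  by congr (_ *: (ddir y _ _ - _)); rewrite /= scaler0 addr0.
- have H0 : (fun s : R => ((s : R^o, 1 : R^o), (1 : R^o, 0 : R^o))) @ t -->
      ((t : R^o, 1 : R^o), (1 : R^o, 0 : R^o)).
    apply: (cvg_pair (G := nbhs (t : R^o, 1 : R^o)) (H := nbhs (1 : R^o, 0 : R^o)));
      last exact: cvg_cst.
    apply: (cvg_pair (G := nbhs (t : R^o)) (H := nbhs (1 : R^o))); last exact: cvg_cst.
    exact: cvg_id.
  exact: (cvg_comp _ _ H0 (yC2.2 ((t, 1), (1, 0)) (conj (abU t tab) I))).
Unshelve. all: by end_near. Qed.

End CurveExtensions.

Section LinearForms.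
Variables (R : realType) (V : tvsType R) (l : V -> R) (Hl : cont_linear_form l).

Lemma linear_formB u w : l (u - w) = l u - l w.
Proof. by have [lin _] := Hl; rewrite addrC -scaleN1r lin mulN1r addrC. Qed.

Lemma linear_formZ c u : l (c *: u) = c * l u.
Proof.
have [lin _] := Hl.
have l0 : l 0 = 0 by rewrite -(subrr 0) linear_formB subrr.
by rewrite -[c *: u]addr0 lin l0 addr0.
Qed.

Lemma dlim_linear_form (q : R -> V) t d : dlim (q : R^o -> V) t 1 d ->
  dlim (fun s : R^o => l (q s) : R^o) t 1 (l d).
Proof.
move=> /dlimE H; apply/dlimE.
apply: cvg_near_eq (cvg_comp _ _ H (Hl.2 d)) _.
by near=> h; rewrite /= linear_formZ linear_formB.
Unshelve. all: by end_near. Qed.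

End LinearForms.

(** Each [l] reduces the claim to the real mean value theorem, so weak differentiability in the
    interior and continuity up to the ends suffice. *)
Lemma separating_constant (R : realType) (V : tvsType R) (L : set (V -> R)) (a b : R) (q : R -> V) :
  (forall l, L l -> cont_linear_form l) ->
  (forall v : V, (forall l, L l -> l v = 0) -> v = 0) ->
  (forall t, a <= t <= b -> {for t, continuous q}) ->
  (forall l t, L l -> a < t < b -> dlim (fun s : R^o => l (q s) : R^o) t 1 0) ->
  forall t, a <= t <= b -> q t = q a.
Proof.
move=> Llin Lsep qc q0 t /andP[at_ tb]; have [->//|nat] := eqVneq t a.
have lat : a < t by rewrite lt_neqAle eq_sym nat.
apply/eqP; rewrite -subr_eq0; apply/eqP/Lsep => l Ll.
have Hl := Llin l Ll; rewrite linear_formB//.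
have [||c _ ->] := @MVT R (fun s => l (q s)) (fun=> 0) a t lat.
- move=> s; rewrite in_itv/= => /andP[as_ st].
  by apply: dlim_is_derive; apply: q0 => //; rewrite as_ (lt_le_trans st tb).
- apply: continuous_subsegment => s /andP[as_ st].
  by apply: (cvg_comp _ _ (qc s _) (Hl.2 _)); rewrite as_ (le_trans st tb).
by rewrite mul0r.
Qed.

(** * Critical curves of class C^2 and the geodesic equation *)

Section Geodesics.
Variables (R : realType) (V : tvsType R) (HV : hausdorff_space V) (Om : set V) (HOm : open Om).
Variables (g : V -> V -> V -> R) (A : V -> V -> V -> V).
Hypotheses (Hg : riemannian_metric Om g) (Hg1 : metric_C1 Om g) (HA : levi_civita Om g A).
Variables (a b : R) (hab : a < b).

Lemma geodesicE (x X X' X'' : R -> V) : curveC2 a b Om x ->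
  (forall t, a <= t <= b -> x t = X t) ->
  (forall t, a <= t <= b -> dlim (X : R^o -> V) t 1 (X' t)) ->
  (forall t, a <= t <= b -> dlim (X' : R^o -> V) t 1 (X'' t)) ->
  (geodesic Om A a b x <->
   forall t, a <= t <= b -> X'' t + A (X t) (X' t) (X' t) = 0).
Proof.
move=> xC2 xX XX' X'X''.
have c1 t : a <= t <= b -> cder a b x t = X' t.
  by move=> tab; exact: (cder_dlim hab HV xX tab (XX' t tab)).
have c2 t : a <= t <= b -> cder2 a b x t = X'' t.
  by move=> tab; exact: (cder_dlim hab HV c1 tab (X'X'' t tab)).
split=> [[_ H] t tab|H]; first by rewrite -(H t tab) c1// c2// xX.
by split=> // t tab; rewrite c1// c2// xX// H.
Qed.

Lemma critical_geodesic (x : R -> V) : curveC2 a b Om x -> energy_critical g a b x ->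
  geodesic Om A a b x.
Proof.
move=> xC2 crit; have [X [X' [X'' [xX XX' X'X'' _]]]] := curveC2_extension xC2.
have xOm := xC2.1.
apply/(geodesicE xC2 xX XX' X'X'') => t tab.
have Ot : Om (X t) by rewrite -xX//; exact: xOm.
have X'c s : a <= s <= b -> {for s, continuous X'} by move=> /X'X''; exact: dlim_continuous.
apply: (metric_eq0 Hg Ot) => w.
have [kap kapE gkap] := euler_lagrange HV HOm Hg Hg1 HA hab xOm xX XX' X'c crit w.
(* [d1] and [d2] evaluate the same one-sided derivative, once by [euler_lagrange] and once by the
   product rule; their difference is the pairing of the covariant acceleration with [w]. *)
have d1 := cder_dlim hab (@norm_hausdorff _ R^o) gkap tab (kapE t tab).
have d2 := cder_dlim hab (@norm_hausdorff _ R^o) (fun _ _ => erefl) tab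
  (dlim_metric HV HOm Hg Hg1 HA Ot (XX' t tab) (X'X'' t tab) (dlim_cst w t)).
move: d2; rewrite d1 addr0 => /esym/eqP; rewrite -subr_eq0 addrK => /eqP.
by rewrite [X'' t + _]addrC.
Qed.

Lemma geodesic_critical (x : R -> V) : curveC2 a b Om x -> geodesic Om A a b x ->
  energy_critical g a b x.
Proof.
move=> xC2 xgeo y yC1 ya yb; have [X [X' [X'' [xX XX' X'X'' _]]]] := curveC2_extension xC2.
have [Y [Y' [yY YY' Y'c]]] := curveC1_extension yC1.
have /(geodesicE xC2 xX XX' X'X'') geo := xgeo.
have xOm := xC2.1.
have Ot t : a <= t <= b -> Om (X t) by move=> tab; rewrite -xX//; exact: xOm.
have X'c s : a <= s <= b -> {for s, continuous X'} by move=> /X'X''; exact: dlim_continuous.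
have H := energy_derivative HV HOm Hg Hg1 HA hab xOm xX XX' X'c yY YY' Y'c.
have aI : a <= a <= b by rewrite lexx ltW.
have bI : a <= b <= b by rewrite lexx ltW.
suff I0 : \int[@lebesgue_measure R]_(t in `[a, b]) g (X t) (X' t) (A (X t) (X' t) (Y t) + Y' t) = 0.
  by rewrite I0 in H.
(* The covariant acceleration is 0, so the integrand is the derivative of [g (X t) (X' t) (Y t)],
   which vanishes at both end points. *)
rewrite (@real_FTC2 _ (fun t => g (X t) (X' t) (Y t)) _ a b hab).
- by rewrite -!yY// ya yb !(metric0r Hg) ?subrr//; exact: Ot.
- move=> t tab; have Xc := dlim_continuous (XX' t tab).
  apply: (cvg_metric HOm Hg1) => //; [exact: Ot|exact: X'c|].
  apply: cvg_tvsD; last exact: Y'c.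
  apply: (cvg_christoffel HA) => //; [exact: Ot|exact: X'c|exact: dlim_continuous (YY' t tab)].
- move=> t tab.
  have := dlim_metric HV HOm Hg Hg1 HA (Ot t tab) (XX' t tab) (X'X'' t tab) (YY' t tab).
  by rewrite [A _ _ _ + X'' t]addrC geo// (metric0l Hg) ?add0r//; exact: Ot.
Qed.

End Geodesics.

(** * Critical curves of class C^1 are of class C^2 *)

Section CriticalRegularity.
Variables (R : realType) (V : tvsType R) (HV : hausdorff_space V) (Om : set V) (HOm : open Om).
Variables (g : V -> V -> V -> R) (A : V -> V -> V -> V).
Hypotheses (Hg : riemannian_metric Om g) (Hg1 : metric_C1 Om g) (HA : levi_civita Om g A).
Variables (a b : R) (hab : a < b).

(* The representing vector [eta] of [l] is chosen at the single point [X t] and kept fixed: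
   nothing is known about its dependence on the base point. *)
Lemma critical_weak_acceleration (x X X' : R -> V) (l : V -> R) :
  (forall t, a <= t <= b -> Om (x t)) -> (forall t, a <= t <= b -> x t = X t) ->
  (forall t, a <= t <= b -> dlim (X : R^o -> V) t 1 (X' t)) ->
  (forall t, a <= t <= b -> {for t, continuous X'}) ->
  energy_critical g a b x ->
  (forall v, Om v -> exists eta : V, forall w, l w = g v eta w) ->
  forall t, a < t < b ->
    dlim (fun s : R^o => l (X' s) : R^o) t 1 (l (- A (X t) (X' t) (X' t))).
Proof.
move=> xOm xX XX' X'c crit lrep t /andP[at_ tb].
have tab : a <= t <= b by rewrite !ltW.
have XOm s : a <= s <= b -> Om (X s) by move=> sab; rewrite -xX//; exact: xOm.
have Ot := XOm t tab; have [eta lE] := lrep (X t) Ot.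
have {}lE w : l w = g (X t) w eta by rewrite lE (metric_sym Hg).
have [kap kapE gkap] := euler_lagrange HV HOm Hg Hg1 HA hab xOm xX XX' X'c crit eta.
have Uc : ((Om `*` [set: V]) `*` [set: V]) ((X t, X' t), eta) by [].
have openU : open ((Om `*` [set: V]) `*` [set: V]) by do 2 apply: open_setXT.
have H0 : (fun h : R => t + h) @ (0 : R)^' --> t.
  suff: (fun h : R => t + h) @ (0 : R)^' --> t + 0 by rewrite addr0.
  by apply: cvgD; [exact: cvg_cst|exact: nbhs_dnbhs].
have X'h : (fun h : R => X' (t + h)) @ (0 : R)^' --> X' t.
  exact: (cvg_comp _ _ H0 (X'c t tab)).
have pF : (fun h : R => ((X t, X' (t + h)), eta)) @ (0 : R)^' --> ((X t, X' t), eta).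
  apply: (cvg_pair (G := nbhs (X t, X' t)) (H := nbhs eta)); last exact: cvg_cst.
  by apply: (cvg_pair (G := nbhs (X t)) (H := nbhs (X' t))) => //; exact: cvg_cst.
have uF : (fun h : R => ((h^-1 *: (X (t + h) - X t), (0 : V)), (0 : V))) @ (0 : R)^' -->
    ((X' t, (0 : V)), (0 : V)).
  apply: (cvg_pair (G := nbhs (X' t, (0 : V))) (H := nbhs (0 : V))); last exact: cvg_cst.
  apply: (cvg_pair (G := nbhs (X' t)) (H := nbhs (0 : V))); last exact: cvg_cst.
  exact: (dlimE _ _ _).1 (XX' t tab).
(* [HQ] is the quotient in which only the foot point moves, from [X t] to [X (t + h)], with vectors
   [X' (t + h)] and [eta]. Subtracting it from [HK] leaves the quotient of [g (X t) (X' s) eta],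
   that is, of [l (X' s)]. *)
pose proof (cvg_quotient openU Hg1 Uc pF (@cvg_id _ (0 : R)^') uF) as HQ.
rewrite (ddir_metric HV HOm Hg Hg1 HA)// !(metric0l Hg, metric0r Hg)// !addr0 in HQ.
have := (dlimE _ _ _).1 (kapE t tab) => HK.
apply/dlimE.
have -> : l (- A (X t) (X' t) (X' t)) = g (X t) (X' t) (A (X t) (X' t) eta)
   - (g (X t) (A (X t) (X' t) (X' t)) eta + g (X t) (X' t) (A (X t) (X' t) eta)).
  by rewrite lE (metric_sym Hg)// (metricNr Hg)// (metric_sym Hg eta)//; ring.
apply: cvg_near_eq (cvg_tvsB HK HQ) _.
near=> h.
have h0 : h != 0 by near: h; exact: nbhs_dnbhs_neq.
have hab' : a <= t + h <= b.
  have h1 : `|h| < t - a by near: h; apply: dnbhs0_lt; rewrite subr_gt0.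
  have h2 : `|h| < b - t by near: h; apply: dnbhs0_lt; rewrite subr_gt0.
  by move: h1 h2; rewrite !ltr_norml => /andP[? ?] /andP[? ?]; apply/andP; split; lra.
rewrite /= scalerA divff// scale1r subrKC !scaler0 !addr0 -!gkap// !lE.
by rewrite /GRing.scale/= -mulrBr; congr (_ * _); ring.
Unshelve. all: by end_near. Qed.

Lemma critical_curveC2 (HVc : seq_complete V) (L : set (V -> R)) (x : R -> V) :
  (forall l, L l -> cont_linear_form l) ->
  (forall v : V, (forall l, L l -> l v = 0) -> v = 0) ->
  (forall l v, L l -> Om v -> exists eta : V, forall w, l w = g v eta w) ->
  curveC1 a b Om x -> energy_critical g a b x -> curveC2 a b Om x.
Proof.
move=> Llin Lsep Lrep xC1 crit; have xOm := xC1.1.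
have [X [X' [xX XX' X'c]]] := curveC1_extension xC1.
have Xc t : a <= t <= b -> {for t, continuous X} by move=> /XX'; exact: dlim_continuous.
pose f t := - A (X t) (X' t) (X' t).
have fc t : a <= t <= b -> {for t, continuous f}.
  move=> tab; apply: cvg_tvsN; apply: (cvg_christoffel HA).
  - by rewrite -xX//; exact: xOm.
  - exact: Xc.
  - exact: X'c.
  - exact: X'c.
have [Z ZE] := primitive_clamp HVc hab fc.
have ext t : a <= t <= b -> a - 1 < t < b + 1 by move=> /andP[? ?]; apply/andP; split; lra.
(* The candidate for [X']: the primitive of the acceleration dictated by the geodesic equation,
   normalised at [a]. *)
pose W t := X' a + (Z t - Z a).
have WE t : a - 1 < t < b + 1 -> dlim (W : R^o -> V) t 1 (f (clamp a b t)).
  move=> tab; have := dlimD (dlim_cst (X' a) t) (dlimB (ZE t tab) (dlim_cst (Z a) t)).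
  by rewrite subr0 add0r.
have WX t : a <= t <= b -> W t = X' t.
  move=> tab; suff H : X' t - W t = X' a - W a.
    by move: H; rewrite /W subrr addr0 subrr => /eqP; rewrite subr_eq0 => /eqP.
  apply: (separating_constant (q := fun t => X' t - W t) Llin Lsep _ _ tab) => [s sab|l s Ll sab].
    by apply: cvg_tvsB; [exact: X'c|exact: dlim_continuous (WE s (ext s sab))].
  have sab' : a <= s <= b by case/andP: sab => ? ?; rewrite !ltW.
  have H1 := critical_weak_acceleration xOm xX XX' X'c crit (fun v => Lrep l v Ll) sab.
  have H2 := dlim_linear_form (Llin l Ll) (WE s (ext s sab')).
  have := dlimB H1 H2; rewrite clamp_id// subrr.
  have -> // : (fun r : R^o => l (X' r - W r) : R^o) = (fun r : R^o => l (X' r) - l (W r)).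
  by apply/funext => r; rewrite (linear_formB (Llin l Ll)).
(* Half of the margin is given up: the next primitive requires [W] continuous on a closed segment
   inside its interval of differentiability. *)
have ext2 t : a - 2^-1 <= t <= b + 2^-1 -> a - 1 < t < b + 1.
  by move=> /andP[? ?]; apply/andP; split; lra.
have ext3 t : a - 2^-1 < t < b + 2^-1 -> a - 1 < t < b + 1.
  by move=> /andP[? ?]; apply/andP; split; lra.
have ext4 t : a <= t <= b -> a - 2^-1 < t < b + 2^-1.
  by move=> /andP[? ?]; apply/andP; split; lra.
have [|t tab|Y YE] := @primitive_exists R V HVc W (a - 2^-1) (b + 2^-1).
- by move: hab => ab; lra.
- exact: dlim_continuous (WE t (ext2 t tab)).
(* [W] equals [X'] only on [[a, b]], so [X] need not be C^2 around the end points; a primitive of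
   [W] supplies a C^2 extension of [x]. *)
pose x2 t := X a + (Y t - Y a).
have x2E t : a - 2^-1 < t < b + 2^-1 -> dlim (x2 : R^o -> V) t 1 (W t).
  move=> tab; have := dlimD (dlim_cst (X a) t) (dlimB (YE t tab) (dlim_cst (Y a) t)).
  by rewrite subr0 add0r.
have x2X t : a <= t <= b -> x2 t = X t.
  move=> tab; suff H : X t - x2 t = X a - x2 a.
    by move: H; rewrite /x2 subrr addr0 subrr => /eqP; rewrite subr_eq0 => /eqP.
  apply: (separating_constant (q := fun t => X t - x2 t) Llin Lsep _ _ tab) => [s sab|l s Ll sab].
    by apply: cvg_tvsB; [exact: Xc|exact: dlim_continuous (x2E s (ext4 s sab))].
  have sab' : a <= s <= b by case/andP: sab => ? ?; rewrite !ltW.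
  have := dlim_linear_form (Llin l Ll) (dlimB (XX' s sab') (x2E s (ext4 s sab'))).
  by rewrite WX// subrr -(subrr 0) linear_formB ?subrr//; exact: Llin.
have oI : open `]a - 2^-1, b + 2^-1[%classic by exact: interval_open.
split => //; exists `]a - 2^-1, b + 2^-1[%classic; split => //.
split; first by move=> t /= /ext4; rewrite in_itv.
exists x2; split; last by move=> t tab; rewrite x2X// xX.
apply: (@isC2_curve _ _ HV _ _ W (fun t => f (clamp a b t))) => // t /=; rewrite in_itv/= => tab.
- exact: (WE t (ext3 t tab)).
- exact: clamp_comp_continuous.
Qed.

End CriticalRegularity.

Unset Implicit Arguments.

Theorem theorem6p3 (R : realType) (V : tvsType R)
  (HV : hausdorff_space V) (HVc : seq_complete V)
  (Om : set V) (HOm : open Om) (a b : R) (hab : a < b)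
  (g : V -> V -> V -> R) (A : V -> V -> V -> V)
  (Hg : riemannian_metric Om g) (Hg1 : metric_C1 Om g)
  (HA : levi_civita Om g A) :
  (forall x : R -> V, curveC2 a b Om x ->
     (energy_critical g a b x <-> geodesic Om A a b x)) /\
  (forall L : set (V -> R),
     (forall l, L l -> cont_linear_form l) ->
     (forall v : V, (forall l, L l -> l v = 0) -> v = 0) ->
     (forall l v, L l -> Om v -> exists eta : V, forall w, l w = g v eta w) ->
     forall x : R -> V, curveC1 a b Om x -> energy_critical g a b x ->
       curveC2 a b Om x /\ geodesic Om A a b x).
Proof.
split=> [x xC2|L Llin Lsep Lrep x xC1 crit].
  split=> [crit|geo]; first exact: (critical_geodesic HV HOm Hg Hg1 HA hab xC2 crit).
  exact: (geodesic_critical HV HOm Hg Hg1 HA hab xC2 geo).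
have xC2 := critical_curveC2 HV HOm Hg Hg1 HA hab HVc Llin Lsep Lrep xC1 crit.
by split=> //; exact: (critical_geodesic HV HOm Hg Hg1 HA hab xC2 crit).
Qed.
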